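(* Let $K\subset\mathbb{R}^n$ be an open, convex set. Suppose that $\sigma\colon\mathbb{R}\to\mathbb{R}$ is a locally Lipschitz function such that $\sigma(0)=0$. Let $f\colon K\to\mathbb{R}$. The following conditions are equivalent: (i) there exists $\gamma\colon K\to\mathbb{R}^n$ such that for any $x\in K$ the function $f$ is $\sigma$-uniformly convex at $x$ with respect to $\gamma(x)\in\mathbb{R}^n$; (ii) for any $x_1,\dotsc,x_{n+1}\in K$ and any non-negative $\lambda_1,\dotsc,\lambda_{n+1}$ that sum up to one there is $$f\Big(\sum_{i=1}^{n+1}\lambda_ix_i\Big)-\sum_{i=1}^{n+1}\lambda_i f(x_i)\leq -\sum_{i=1}^{n+1}\lambda_i\sigma\Big(\Big\| \sum_{j=1}^{n+1}\lambda_jx_j-x_i \Big\|\Big);$$ (iii) for any bounded one-step martingale $(X_0,X_1)$ with values in $K$ there is $$\mathbb{E}\big(f(X_0)-f(X_1)\big)\leq -\mathbb{E}\sigma(\|X_0-X_1\|).$$ Also, the following conditions are equivalent: (i') there exists $\gamma\colon K\to\mathbb{R}^n$ such that for any $x\in K$ the function $f$ is $\sigma$-uniformly smooth at $x$ with respect to $\gamma(x)\in\mathbb{R}^n$; (ii') for any $x_1,\dotsc,x_{n+1}\in K$ and any non-negative $\lambda_1,\dotsc,\lambda_{n+1}$ that sum up to one there is $$f\Big(\sum_{i=1}^{n+1}\lambda_ix_i\Big)-\sum_{i=1}^{n+1}\lambda_i f(x_i)\geq -\sum_{i=1}^{n+1}\lambda_i\sigma\Big(\Big\| \sum_{j=1}^{n+1}\lambda_jx_j-x_i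 \Big\|\Big);$$ (iii') for any bounded one-step martingale $(X_0,X_1)$ with values in $K$ there is $$\mathbb{E}\big(f(X_0)-f(X_1)\big)\geq -\mathbb{E}\sigma(\|X_0-X_1\|).$$ Moreover, any function $f$ that satisfies one of the conditions (i), (ii), (iii), (i'), (ii'), (iii') is locally Lipschitz in $K$. If it is assumed that $\sigma$ and $f$ are continuous (in place of $\sigma$ being locally Lipschitz), then the respective conditions at a single $x\in K$ are equivalent.
   Context: $\|\cdot\|$ is the Euclidean norm. For $\sigma\colon\mathbb{R}\to\mathbb{R}$, $\gamma\in\mathbb{R}^n$ and $x\in K$, a function $f\colon K\to\mathbb{R}$ is $\sigma$-uniformly convex at $x$ with respect to $\gamma$ if $f(x)+\sigma(\|y-x\|)+\langle \gamma,y-x\rangle\leq f(y)$ for all $y\in K$; it is $\sigma$-uniformly smooth at $x$ with respect to $\gamma$ if $f(x)+\sigma(\|y-x\|)+\langle \gamma,y-x\rangle\geq f(y)$ for all $y\in K$. A one-step martingale is a pair $(X_0,X_1)$ of random vectors with $\mathbb{E}(X_1|X_0)=X_0$. ''The respective conditions at a single $x\in K$'' are, in the convex case: there is $\gamma\in\mathbb{R}^n$ such that $f$ is $\sigma$-uniformly convex at $x$ with respect to $\gamma$; the inequality in (ii) holds for all $x_i\in K$, $\lambda_i\ge0$ with $\sum_i\lambda_i=1$ and $\sum_i\lambda_ix_i=x$; and $\mathbb{E}(f(x)-f(X))\le-\mathbb{E}\sigma(\|x-X\|)$ for every bounded random variable $X$ with values in $K$ and $\mathbb{E}X=x$. In the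 smooth case they are the analogous conditions with ''uniformly smooth'' and with the inequalities of (ii') and (iii') (reversed sign).
   Formalization: In (iii) and (iii') the inequality is required only for bounded martingales for which E(f(X_0)-f(X_1)) exists in [-∞,+∞]; it can be undefined (∞-∞) even under (i), e.g. K=(0,1), f(t)=1/t, σ=0. *)

(* Defs.v *)
From HB Require Import structures.
From mathcomp Require Import all_boot all_order all_algebra.
From mathcomp Require Import all_classical all_reals all_analysis.

Set Implicit Arguments.
Unset Strict Implicit.
Unset Printing Implicit Defensive.

Import Order.TTheory GRing.Theory Num.Theory.
Import numFieldNormedType.Exports.

Local Open Scope classical_set_scope.
Local Open Scope ring_scope.

(* The library norm on 'rV[R]_n is the sup norm; it induces the same topology
   as the Euclidean norm below, which is the one used in all inequalities. *)
Definition dotv (R : realType) (n : nat) (u v : 'rV[R]_n) : R :=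
  \sum_(i < n) u 0 i * v 0 i.

Definition enorm (R : realType) (n : nat) (u : 'rV[R]_n) : R :=
  Num.sqrt (dotv u u).

Definition locally_lipschitz_on (R : realType) (V : normedModType R)
    (nrm : V -> R) (A : set V) (g : V -> R) : Prop :=
  forall x, A x -> exists2 U : set V, nbhs x U &
    exists L : R, forall y z, (U `&` A) y -> (U `&` A) z ->
      `|g y - g z| <= L * nrm (y - z).

(* A function f : K -> R is represented by a total function of which only the
   values on K are ever used. *)
Definition uniformly_convex_at (R : realType) (n : nat) (K : set 'rV[R]_n)
    (sigma : R -> R) (f : 'rV[R]_n -> R) (x gamma : 'rV[R]_n) : Prop :=
  forall y, K y -> f x + sigma (enorm (y - x)) + dotv gamma (y - x) <= f y.

Definition uniformly_smooth_at (R : realType) (n : nat) (K : set 'rV[R]_n)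
    (sigma : R -> R) (f : 'rV[R]_n -> R) (x gamma : 'rV[R]_n) : Prop :=
  forall y, K y -> f x + sigma (enorm (y - x)) + dotv gamma (y - x) >= f y.

Definition convex_weights (R : realType) (m : nat) (lam : 'I_m -> R) : Prop :=
  (forall i, 0 <= lam i) /\ \sum_(i < m) lam i = 1.

Definition barycenter (R : realType) (n m : nat)
    (lam : 'I_m -> R) (xs : 'I_m -> 'rV[R]_n) : 'rV[R]_n :=
  \sum_(i < m) lam i *: xs i.

Definition jensen_convex (R : realType) (n m : nat) (sigma : R -> R)
    (f : 'rV[R]_n -> R) (lam : 'I_m -> R) (xs : 'I_m -> 'rV[R]_n) : Prop :=
  f (barycenter lam xs) - \sum_(i < m) lam i * f (xs i) <=
  - \sum_(i < m) lam i * sigma (enorm (barycenter lam xs - xs i)).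

Definition jensen_smooth (R : realType) (n m : nat) (sigma : R -> R)
    (f : 'rV[R]_n -> R) (lam : 'I_m -> R) (xs : 'I_m -> 'rV[R]_n) : Prop :=
  f (barycenter lam xs) - \sum_(i < m) lam i * f (xs i) >=
  - \sum_(i < m) lam i * sigma (enorm (barycenter lam xs - xs i)).

(* R^n with its Borel sigma-algebra. *)
Definition borel_rV (R : realType) (n : nat) :=
  g_sigma_algebraType (@open 'rV[R]_n).

Definition coordinate (R : realType) (n : nat) (T : Type)
    (X : T -> borel_rV R n) (i : 'I_n) : T -> R :=
  fun w => (X w : 'rV[R]_n) 0 i.

Definition bounded_rv (R : realType) (n : nat) (T : Type)
    (X : T -> borel_rV R n) : Prop :=
  exists M : R, forall w, enorm (X w) <= M.

(* Z is a version of E(Y | X), i.e. of the conditional expectation of Y with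
   respect to the sigma-algebra generated by X. *)
Definition is_cond_expectation (R : realType) (n : nat) (d : measure_display)
    (T : measurableType d) (P : probability T R) (X : {RV P >-> borel_rV R n})
    (Y Z : T -> R) : Prop :=
  [/\ P.-integrable setT (EFin \o Y),
      measurable_fun setT (Z : g_sigma_algebra_preimageType X -> R),
      P.-integrable setT (EFin \o Z) &
      forall A : set T, g_sigma_algebra_preimage X A ->
        (\int[P]_(w in A) (Z w)%:E = \int[P]_(w in A) (Y w)%:E)%E].

(* E(X1 | X0) = X0, coordinatewise. *)
Definition one_step_martingale (R : realType) (n : nat) (d : measure_display)
    (T : measurableType d) (P : probability T R)
    (X0 X1 : {RV P >-> borel_rV R n}) : Prop :=
  forall i : 'I_n,
    is_cond_expectation X0 (coordinate X1 i) (coordinate X0 i).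

Definition has_mean (R : realType) (n : nat) (d : measure_display)
    (T : measurableType d) (P : probability T R)
    (X : {RV P >-> borel_rV R n}) (x : 'rV[R]_n) : Prop :=
  forall i : 'I_n, 'E_P[coordinate X i]%E = (x 0 i)%:E.

(* Y has a well-defined expectation in [-oo, +oo]. This matters because 'E_P is
   total, with the convention +oo - +oo = -oo. *)
Definition expectation_exists (R : realType) (d : measure_display)
    (T : measurableType d) (P : probability T R) (Y : T -> R) : Prop :=
  measurable_fun setT Y /\
  ((\int[P]_w ((EFin \o Y)^\+ w) < +oo)%E \/
   (\int[P]_w ((EFin \o Y)^\- w) < +oo)%E).

(* X0 and X1 are bounded, but f may be unbounded near the boundary of K, and then
   f(X0) - f(X1) may have no expectation even if f is convex and sigma = 0: take
   K = ]0, 1[, f(t) = 1/t, X0 < 2/3 with E(1/X0) = +oo, and X1 = X0 (1 + e/2)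
   with e an independent random sign. Hence the inequality is required whenever
   the expectation exists; it then holds in [-oo, +oo]. *)
Definition martingale_convex (R : realType) (n : nat) (K : set 'rV[R]_n)
    (sigma : R -> R) (f : 'rV[R]_n -> R) : Prop :=
  forall (d : measure_display) (T : measurableType d) (P : probability T R)
    (X0 X1 : {RV P >-> borel_rV R n}),
  (forall w, K (X0 w)) -> (forall w, K (X1 w)) ->
  bounded_rv X0 -> bounded_rv X1 -> one_step_martingale X0 X1 ->
  expectation_exists P (fun w => f (X0 w) - f (X1 w)) ->
  ('E_P[fun w => (f (X0 w) - f (X1 w))%R] <=
   - 'E_P[fun w => sigma (enorm ((X0 w : 'rV[R]_n) - X1 w)%R)])%E.

Definition martingale_smooth (R : realType) (n : nat) (K : set 'rV[R]_n)
    (sigma : R -> R) (f : 'rV[R]_n -> R) : Prop :=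
  forall (d : measure_display) (T : measurableType d) (P : probability T R)
    (X0 X1 : {RV P >-> borel_rV R n}),
  (forall w, K (X0 w)) -> (forall w, K (X1 w)) ->
  bounded_rv X0 -> bounded_rv X1 -> one_step_martingale X0 X1 ->
  expectation_exists P (fun w => f (X0 w) - f (X1 w)) ->
  ('E_P[fun w => (f (X0 w) - f (X1 w))%R] >=
   - 'E_P[fun w => sigma (enorm ((X0 w : 'rV[R]_n) - X1 w)%R)])%E.

(* Here uniform convexity (smoothness) bounds f x - f (X w) from above (below) by
   a bounded random variable, so the expectation always exists; its existence is
   made part of the condition instead of being assumed. *)
Definition mean_convex_at (R : realType) (n : nat) (K : set 'rV[R]_n)
    (sigma : R -> R) (f : 'rV[R]_n -> R) (x : 'rV[R]_n) : Prop :=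
  forall (d : measure_display) (T : measurableType d) (P : probability T R)
    (X : {RV P >-> borel_rV R n}),
  (forall w, K (X w)) -> bounded_rv X -> has_mean X x ->
  expectation_exists P (fun w => f x - f (X w)) /\
  ('E_P[fun w => (f x - f (X w))%R] <=
   - 'E_P[fun w => sigma (enorm (x - X w)%R)])%E.

Definition mean_smooth_at (R : realType) (n : nat) (K : set 'rV[R]_n)
    (sigma : R -> R) (f : 'rV[R]_n -> R) (x : 'rV[R]_n) : Prop :=
  forall (d : measure_display) (T : measurableType d) (P : probability T R)
    (X : {RV P >-> borel_rV R n}),
  (forall w, K (X w)) -> bounded_rv X -> has_mean X x ->
  expectation_exists P (fun w => f x - f (X w)) /\
  ('E_P[fun w => (f x - f (X w))%R] >=
   - 'E_P[fun w => sigma (enorm (x - X w)%R)])%E.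

Definition uniformly_convex_on (R : realType) (n : nat) (K : set 'rV[R]_n)
    (sigma : R -> R) (f : 'rV[R]_n -> R) : Prop :=
  exists gamma : 'rV[R]_n -> 'rV[R]_n,
    forall x, K x -> uniformly_convex_at K sigma f x (gamma x).

Definition uniformly_smooth_on (R : realType) (n : nat) (K : set 'rV[R]_n)
    (sigma : R -> R) (f : 'rV[R]_n -> R) : Prop :=
  exists gamma : 'rV[R]_n -> 'rV[R]_n,
    forall x, K x -> uniformly_smooth_at K sigma f x (gamma x).

Definition jensen_convex_on (R : realType) (n : nat) (K : set 'rV[R]_n)
    (sigma : R -> R) (f : 'rV[R]_n -> R) : Prop :=
  forall (xs : 'I_n.+1 -> 'rV[R]_n) (lam : 'I_n.+1 -> R),
    (forall i, K (xs i)) -> convex_weights lam -> jensen_convex sigma f lam xs.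

Definition jensen_smooth_on (R : realType) (n : nat) (K : set 'rV[R]_n)
    (sigma : R -> R) (f : 'rV[R]_n -> R) : Prop :=
  forall (xs : 'I_n.+1 -> 'rV[R]_n) (lam : 'I_n.+1 -> R),
    (forall i, K (xs i)) -> convex_weights lam -> jensen_smooth sigma f lam xs.

Definition jensen_convex_at (R : realType) (n : nat) (K : set 'rV[R]_n)
    (sigma : R -> R) (f : 'rV[R]_n -> R) (x : 'rV[R]_n) : Prop :=
  forall (xs : 'I_n.+1 -> 'rV[R]_n) (lam : 'I_n.+1 -> R),
    (forall i, K (xs i)) -> convex_weights lam -> barycenter lam xs = x ->
    jensen_convex sigma f lam xs.

Definition jensen_smooth_at (R : realType) (n : nat) (K : set 'rV[R]_n)
    (sigma : R -> R) (f : 'rV[R]_n -> R) (x : 'rV[R]_n) : Prop :=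
  forall (xs : 'I_n.+1 -> 'rV[R]_n) (lam : 'I_n.+1 -> R),
    (forall i, K (xs i)) -> convex_weights lam -> barycenter lam xs = x ->
    jensen_smooth sigma f lam xs.

(* Main.v *)
(* Smoothness of [f] for [sigma] is convexity of [- f] for [- sigma], so only the
   convex case matters.  Put [g y = f y - f x - sigma |y - x|].  Jensen's
   inequality at [x] with [n + 1] points extends to any number of points by
   Caratheodory's argument: a minimizer of [sum_i lam_i g(x_i)] under
   [sum_i lam_i x_i = x] can be taken with affinely independent support.  Hence
   the cone generated by the pairs [(y - x, g y)] lies, over [0], in the upper
   half-line, and Hahn-Banach provides [gamma] with [<gamma, y - x> <= g y].

   Taking expectations in this inequality gives the condition on the mean.  For a
   martingale, [gamma] need not be measurable; so, given [eps > 0], cover [K] by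
   countably many cells with centers [a_j] on which replacing [X0] by [a_j] in the
   inequality costs at most [eps], and use [gamma (a_j)] on the whole event that
   [X0] is in the [j]-th cell, where [<gamma (a_j), X1 - X0>] has integral [0].
   The converse implications use random vectors with finitely many values. *)

Require Import Defs.
From HB Require Import structures.
From mathcomp Require Import all_boot all_order all_algebra.
From mathcomp Require Import all_classical all_reals all_analysis.
From mathcomp Require Import measurable_realfun.
From mathcomp Require Import ring lra.

Set Implicit Arguments.
Unset Strict Implicit.
Unset Printing Implicit Defensive.

Import Order.TTheory GRing.Theory Num.Theory.
Import numFieldNormedType.Exports.

Local Open Scope classical_set_scope.
Local Open Scope ring_scope.

(** * Euclidean inner product and norm, compared with the sup norm of the library *)

Section euclidean.
Variables (R : realType) (n : nat).
Implicit Types (u v w : 'rV[R]_n) (t : R).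

Lemma dotvC u v : dotv u v = dotv v u.
Proof. by apply: eq_bigr => i _; rewrite mulrC. Qed.

Lemma dotvDr u v w : dotv u (v + w) = dotv u v + dotv u w.
Proof. by rewrite -big_split; apply: eq_bigr => i _; rewrite mxE mulrDr. Qed.

Lemma dotvZr t u v : dotv u (t *: v) = t * dotv u v.
Proof. by rewrite mulr_sumr; apply: eq_bigr => i _; rewrite mxE mulrCA. Qed.

Lemma dotvNr u v : dotv u (- v) = - dotv u v.
Proof. by rewrite -scaleN1r dotvZr mulN1r. Qed.

Lemma dotvBr u v w : dotv u (v - w) = dotv u v - dotv u w.
Proof. by rewrite dotvDr dotvNr. Qed.

Lemma dotvNl u v : dotv (- u) v = - dotv u v.
Proof. by rewrite dotvC dotvNr dotvC. Qed.

Lemma dotv0r u : dotv u 0 = 0.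
Proof. by rewrite -(scale0r 0) dotvZr mul0r. Qed.

Lemma dotv_sumr (I : Type) (s : seq I) (P : pred I) u (F : I -> 'rV[R]_n) :
  dotv u (\sum_(i <- s | P i) F i) = \sum_(i <- s | P i) dotv u (F i).
Proof.
by apply: (big_morph (dotv u)) => [v w|]; rewrite ?dotv0r // dotvDr.
Qed.

Lemma dotv_ge0 u : 0 <= dotv u u.
Proof. by apply: sumr_ge0 => i _; rewrite -expr2 sqr_ge0. Qed.

Lemma enorm_ge0 u : 0 <= enorm u.
Proof. exact: sqrtr_ge0. Qed.

Lemma sqr_enorm u : enorm u ^+ 2 = dotv u u.
Proof. by rewrite sqr_sqrtr // dotv_ge0. Qed.

Lemma enormN u : enorm (- u) = enorm u.
Proof. by rewrite /enorm dotvNr dotvNl opprK. Qed.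

Lemma enormB u v : enorm (u - v) = enorm (v - u).
Proof. by rewrite -enormN opprB. Qed.

Lemma enorm0 : enorm (0 : 'rV[R]_n) = 0.
Proof. by rewrite /enorm dotv0r sqrtr0. Qed.

Lemma ler_coord_enorm u i : `|u 0 i| <= enorm u.
Proof.
rewrite -sqrtr_sqr ler_wsqrtr // /dotv (bigD1 i) //= -expr2 lerDl.
by apply: sumr_ge0 => j _; rewrite -expr2 sqr_ge0.
Qed.

Lemma enorm_eq0 u : enorm u = 0 -> u = 0.
Proof.
move=> u0; apply/rowP => i; rewrite mxE; apply/eqP.
by rewrite -normr_le0 -u0 ler_coord_enorm.
Qed.

(** Cauchy-Schwarz: with [a = enorm u], [b = enorm v] and [c = dotv u v], the square norm of
    [b *: u - a *: v] is [2 * a * b * (a * b - c)]. The cases [a = 0] and [b = 0] are settled first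
    so that [a * b] can be cancelled. *)
Lemma dotv_le_enorm u v : dotv u v <= enorm u * enorm v.
Proof.
have [u0|u_neq0] := eqVneq (enorm u) 0.
  by rewrite (enorm_eq0 u0) dotvC dotv0r enorm0 mul0r.
have [v0|v_neq0] := eqVneq (enorm v) 0.
  by rewrite (enorm_eq0 v0) dotv0r enorm0 mulr0.
have uv_gt0 : 0 < enorm u * enorm v.
  by rewrite mulr_gt0 // lt0r enorm_ge0 ?u_neq0 ?v_neq0.
have := dotv_ge0 (enorm v *: u - enorm u *: v).
rewrite dotvBr !dotvZr !(dotvC (_ - _)) !dotvBr !dotvZr -!sqr_enorm (dotvC v u).
move: uv_gt0; set a := enorm u; set b := enorm v; set c := dotv u v => ab_gt0 h.
by rewrite -subr_ge0 -(pmulr_rge0 _ ab_gt0); lra.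
Qed.

Lemma ler_enormD u v : enorm (u + v) <= enorm u + enorm v.
Proof.
rewrite -(@ler_pXn2r _ 2) ?nnegrE ?addr_ge0 ?enorm_ge0 //.
rewrite sqr_enorm dotvDr !(dotvC (_ + _)) !dotvDr (dotvC v u) sqrrD !sqr_enorm.
have := dotv_le_enorm u v; lra.
Qed.

Lemma ler_enormB_dist u v : `|enorm u - enorm v| <= enorm (u - v).
Proof.
have h (a b : 'rV[R]_n) : enorm a - enorm b <= enorm (a - b).
  by rewrite lerBlDr -{1}(subrK b a) ler_enormD.
by rewrite ler_norml h andbT lerNl opprB enormB h.
Qed.

Lemma ler_dotv_sum_enorm u v : `|dotv u v| <= (\sum_i `|u 0 i|) * enorm v.
Proof.
rewrite mulr_suml; apply: le_trans (ler_norm_sum _ _ _) _.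
by apply: ler_sum => i _; rewrite normrM ler_wpM2l // ler_coord_enorm.
Qed.

Lemma ler_coord_norm u i : `|u 0 i| <= `|u|.
Proof.
rewrite [leRHS]mx_normrE.
exact: (le_bigmax _ (fun ij : 'I_1 * 'I_n => `|u ij.1 ij.2|) (0, i)).
Qed.

Lemma ler_enorm_norm u : enorm u <= n%:R * `|u|.
Proof.
rewrite -(@ler_pXn2r _ 2) ?nnegrE ?mulr_ge0 ?enorm_ge0 //.
rewrite sqr_enorm.
apply: (@le_trans _ _ (\sum_(i < n) `|u| ^+ 2)).
  apply: ler_sum => i _; rewrite -expr2 -real_normK ?num_real //.
  by rewrite ler_pXn2r ?nnegrE // ler_coord_norm.
rewrite sumr_const card_ord -[leLHS]mulr_natl exprMn ler_wpM2r ?sqr_ge0 //.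
by rewrite -natrX ler_nat; case: (n) => // k; rewrite leq_pmulr.
Qed.

End euclidean.

(** * From Jensen's inequality at a point to an affine minorant: Caratheodory and Hahn-Banach *)

Section jensen_to_subgradient.
Variables (R : realType) (n : nat).

(** The rows [(1, y i)] are more than [n + 1] vectors in dimension [n + 1], so their matrix has a
    nonzero left kernel vector; its entries are [mu]. *)
Lemma affine_dependence m (y : 'I_m -> 'rV[R]_n) : (n.+1 < m)%N ->
  exists mu : 'I_m -> R, [/\ \sum_i mu i = 0, \sum_i mu i *: y i = 0 &
    exists i, mu i != 0].
Proof.
move=> n_lt_m.
pose A : 'M[R]_(m, 1 + n) :=
  row_mx (const_mx 1) (\matrix_(i, j) y i 0 j).
have kerA : kermx A != 0.
  rewrite kermx_eq0 -row_leq_rank -ltnNge.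
  exact: leq_ltn_trans (rank_leq_col A) n_lt_m.
have [i kerAi] : exists i, row i (kermx A) != 0.
  apply/existsP; apply: contraNT kerA; rewrite negb_exists => /forallP h.
  by apply/eqP/row_matrixP => i; rewrite row0; have /negPn/eqP := h i.
have uA0 : row i (kermx A) *m A = 0 by rewrite -row_mul mulmx_ker row0.
move: (row i (kermx A)) uA0 kerAi => u.
rewrite mul_mx_row -[X in _ = X]row_mx0 => /eq_row_mx[u1 uy] u_neq0.
exists (u 0); split.
- have /matrixP/(_ 0 0) := u1; rewrite !mxE => u10; rewrite -[RHS]u10.
  by apply: eq_bigr => j _; rewrite mxE mulr1.
- apply/rowP => k; have /matrixP/(_ 0 k) := uy; rewrite !mxE summxE => uyk.
  rewrite -[RHS]uyk.
  by apply: eq_bigr => j _; rewrite !mxE.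
- apply/existsP; apply: contraNT u_neq0; rewrite negb_exists => /forallP h.
  by apply/eqP/rowP => k; have /negPn/eqP := h k; rewrite mxE.
Qed.

(** Moving the weights along an affine dependence [mu] preserves total mass and barycenter. The sign
    of [mu] is chosen so that the sum against [g] does not increase, and the motion stops when a
    first weight vanishes. *)
Lemma caratheodory_step m (y : 'I_m -> 'rV[R]_n) (c g : 'I_m -> R) :
  (n.+1 < m)%N -> (forall i, 0 <= c i) ->
  exists c' : 'I_m -> R, [/\ forall i, 0 <= c' i, \sum_i c' i = \sum_i c i,
    \sum_i c' i *: y i = \sum_i c i *: y i,
    \sum_i c' i * g i <= \sum_i c i * g i & exists i, c' i = 0].
Proof.
move=> n_lt_m c_ge0.
have [mu [mu1 muy [i0 mu_neq0] mug]] : exists mu : 'I_m -> R,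
    [/\ \sum_i mu i = 0, \sum_i mu i *: y i = 0, exists i, mu i != 0 &
      \sum_i mu i * g i <= 0].
  have [mu [mu1 muy [i mu_neq0]]] := affine_dependence y n_lt_m.
  have [mug|mug] := leP (\sum_i mu i * g i) 0.
    by exists mu; split=> //; exists i.
  exists (fun i => - mu i); split.
  - by rewrite sumrN mu1 oppr0.
  - rewrite -[RHS]oppr0 -[in RHS]muy -sumrN; apply: eq_bigr => j _; exact: scaleNr.
  - by exists i; rewrite oppr_eq0.
  - rewrite -oppr_ge0 -sumrN ltW //.
    by under eq_bigr do rewrite mulNr opprK.
have {i0 mu_neq0} [i0 mu_lt0] : exists i, mu i < 0.
  apply/existsP; apply: contraNT mu_neq0; rewrite negb_exists => /forallP h.
  have mu_ge0 i : 0 <= mu i by have := h i; rewrite -leNgt.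
  by have /psumr_eq0P -> := mu1.
(* Only negative entries of [mu] make weights decrease, so the smallest ratio [c i / - mu i] over
   them is the largest admissible step [t], and it kills the weight at its minimizer. *)
have [i mui ratio_min] := @arg_minP _ _ _ i0 (fun i => mu i < 0)
  (fun i => c i / - mu i) mu_lt0.
pose t := c i / - mu i.
have t_ge0 : 0 <= t by rewrite divr_ge0 // oppr_ge0 ltW.
exists (fun j => c j + t * mu j); split.
- move=> j; have [muj|muj] := leP 0 (mu j).
    by rewrite addr_ge0 // mulr_ge0.
  have := ratio_min j muj; rewrite -/t ler_pdivlMr ?oppr_gt0 //.
  by rewrite mulrN -subr_ge0 opprK.
- by rewrite big_split /= -mulr_sumr mu1 mulr0 addr0.
- under eq_bigr do rewrite scalerDl -scalerA.
  by rewrite big_split /= -scaler_sumr muy scaler0 addr0.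
- under eq_bigr do rewrite mulrDl -mulrA.
  by rewrite big_split /= -mulr_sumr gerDl mulr_ge0_le0.
- exists i; rewrite /t invrN mulrN mulNr mulfVK ?subrr //.
  by rewrite lt_eqF.
Qed.

Variables (K : set 'rV[R]_n) (x : 'rV[R]_n) (g : 'rV[R]_n -> R).
Hypothesis jensen_g : forall (xs : 'I_n.+1 -> 'rV[R]_n) (lam : 'I_n.+1 -> R),
  (forall i, K (xs i)) -> convex_weights lam -> barycenter lam xs = x ->
  0 <= \sum_i lam i * g (xs i).

(** Induction on the number of points. Above [n + 1] points, [caratheodory_step] lets one be
    dropped; up to [n + 1], the family is padded to exactly [n + 1] points by copies of [x] with
    weight 0. *)
Lemma jensen_any_size m (y : 'I_m -> 'rV[R]_n) (c : 'I_m -> R) : K x ->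
  (forall i, K (y i)) -> convex_weights c -> barycenter c y = x ->
  0 <= \sum_i c i * g (y i).
Proof.
move=> Kx; elim: m y c => [|m IHm] y c Ky [c_ge0 c1] cy.
  by rewrite big_ord0.
have [n_lt_m|m_le_n] := ltnP n.+1 m.+1.
  have [c' [c'_ge0 c'1 c'y c'g [i c'i]]] :=
    caratheodory_step y (g \o y) n_lt_m c_ge0.
  apply: le_trans c'g => /=.
  rewrite (bigD1_ord i) //= c'i mul0r add0r.
  apply: (IHm (fun j => y (lift i j)) (fun j => c' (lift i j))) => //.
  - by split=> //; rewrite -c1 -c'1 [RHS](bigD1_ord i) //= c'i add0r.
  - rewrite -[RHS]cy /barycenter -c'y [RHS](bigD1_ord i) //=.
    by rewrite c'i scale0r add0r.
pose z (i : 'I_n.+1) := if insub (val i) is Some j then y j else x.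
pose l (i : 'I_n.+1) := if insub (val i) is Some j then c j else 0.
(* Stated for a general summand [F], as it serves three times: for the barycenter, for the sum
   against [g] and for the total weight. *)
have padE (V : zmodType) (F : R -> 'rV[R]_n -> V) : F 0 x = 0 ->
    \sum_i F (l i) (z i) = \sum_i F (c i) (y i).
  move=> F0.
  pose H (i : nat) : V := if insub i is Some j then F (c j) (y j) else 0.
  rewrite [RHS](eq_bigr (fun i : 'I_m.+1 => H i)) => [|i _]; last first.
    by rewrite /H valK.
  rewrite (big_ord_widen _ H m_le_n) [RHS]big_mkcond.
  apply: eq_bigr => i _; rewrite /l /z /H.
  by case: insubP => [j ->//|/negPf ->].
have lz : barycenter l z = x by rewrite -[RHS]cy; apply: padE; rewrite scale0r.
rewrite -(padE _ (fun a v => a * g v)) ?mul0r //.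
apply: jensen_g => //.
- by move=> i; rewrite /z; case: insubP.
- split; last by rewrite -c1; apply: (padE _ (fun a _ => a)).
  by move=> i; rewrite /l; case: insubP.
Qed.

(** Dividing by the total mass [C] turns the coefficients into convex weights with barycenter [x];
    if [C] is 0, every coefficient vanishes. *)
Lemma jensen_cone (s : seq (R * 'rV[R]_n)) : K x ->
  (forall p, p \in s -> 0 <= p.1 /\ K p.2) ->
  \sum_(p <- s) p.1 *: (p.2 - x) = 0 -> 0 <= \sum_(p <- s) p.1 * g p.2.
Proof.
move=> Kx s_ok.
rewrite !(big_tnth _ _ s); set p := tnth _ => p0.
have {}s_ok i : 0 <= (p i).1 /\ K (p i).2 by apply: s_ok; exact: mem_tnth.
have p_ge0 i : 0 <= (p i).1 by case: (s_ok i).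
have [C0|C_neq0] := eqVneq (\sum_i (p i).1) 0.
  have /psumr_eq0P p1 := C0.
  by rewrite big1 // => i _; rewrite p1 ?mul0r.
have C_gt0 : 0 < \sum_i (p i).1 by rewrite lt0r C_neq0 sumr_ge0.
set C := \sum_i _ in C_neq0 C_gt0.
have := @jensen_any_size _ (fun i => (p i).2) (fun i => C^-1 * (p i).1) Kx.
under eq_bigr do rewrite -mulrA.
rewrite -mulr_sumr pmulr_rge0 ?invr_gt0 //; apply.
- by move=> i; case: (s_ok i).
- split=> [i|]; first by rewrite mulr_ge0 // invr_ge0 ltW.
  by rewrite -mulr_sumr mulVf.
- rewrite /barycenter; under eq_bigr do rewrite -scalerA.
  rewrite -scaler_sumr -[RHS]scale1r -(mulVf C_neq0) -scalerA; congr (_ *: _).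
  apply/eqP; rewrite -subr_eq0 -[X in _ == X]p0 {1}/C scaler_suml -sumrB.
  by apply/eqP/eq_bigr => i _; rewrite scalerBr.
Qed.


End jensen_to_subgradient.

(* Hahn-Banach for a convex cone [C] in [R^n * R]; the induction extends [gamma]
   from vectors supported on the first [k] coordinates to the next coordinate. *)
Lemma cone_linear_minorant (R : realType) (n : nat) (C : 'rV[R]_n -> R -> Prop) :
  (forall u v r q, C u r -> C v q -> C (u + v) (r + q)) ->
  (forall (t : R) v r, 0 < t -> C v r -> C (t *: v) (t * r)) ->
  (forall v, exists r, C v r) -> (forall r, C 0 r -> 0 <= r) ->
  exists gamma : 'rV[R]_n, forall v r, C v r -> dotv gamma v <= r.
Proof.
move=> CD CZ C_total C0.
suff H k : (k <= n)%N -> exists gamma : 'rV[R]_n, forall (v : 'rV[R]_n) r,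
    (forall i : 'I_n, (k <= i)%N -> v 0 i = 0) -> C v r -> dotv gamma v <= r.
  have [gamma gammaP] := H n (leqnn n).
  by exists gamma => v r; apply: gammaP => i; rewrite leqNgt ltn_ord.
elim: k => [_|k IHk k_lt_n].
  exists 0 => v r v0 Cvr; rewrite dotvC dotv0r C0 //.
  by rewrite (_ : 0 = v) //; apply/rowP => i; rewrite v0 ?mxE.
have [gamma gammaP] := IHk (ltnW k_lt_n).
pose i0 := Ordinal k_lt_n; pose e : 'rV[R]_n := delta_mx 0 i0.
pose low (v : 'rV[R]_n) := forall i : 'I_n, (k <= i)%N -> v 0 i = 0.
have low0 : low 0 by move=> i _; rewrite mxE.
have lowD u v : low u -> low v -> low (u + v).
  by move=> lu lv i ki; rewrite mxE lu ?lv ?addr0.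
have lowZ t v : low v -> low (t *: v).
  by move=> lv i ki; rewrite mxE lv ?mulr0.
(* The value [a] of the extended functional at [e] must lie above [S] and below every
   [q - dotv gamma w] with [C (w + e) q]. Adding a cone element over [u - e] to one over [w + e]
   eliminates [e], so the induction hypothesis makes these demands compatible and [a := sup S]
   works. *)
pose S := [set s | exists u r, [/\ low u, C (u - e) r & s = dotv gamma u - r]].
have S_le w q : low w -> C (w + e) q -> ubound S (q - dotv gamma w).
  move=> lw Cwq s [u [r [lu Cur ->]]].
  have := gammaP _ _ (lowD _ _ lu lw).
  move=> /(_ (r + q)); rewrite -[in C _ _](subrK e u) -addrA [e + w]addrC.
  by move=> /(_ (CD _ _ _ _ Cur Cwq)); rewrite dotvDr; lra.
have S_ub : has_ubound S.
  have [q Ceq] := C_total e; exists (q - dotv gamma 0).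
  by apply: S_le => //; rewrite add0r.
have S_neq0 : S !=set0.
  by have [r Cer] := C_total (0 - e); exists (dotv gamma 0 - r), 0, r.
pose a := sup S; exists (gamma + (a - gamma 0 i0) *: e) => v r v_low Cvr.
pose t := v 0 i0; pose u := v - t *: e.
have dote w : dotv e w = w 0 i0.
  rewrite /dotv (bigD1 i0) //= big1 ?addr0 ?mxE ?eqxx ?mul1r // => j ji0.
  by rewrite mxE (negPf ji0) andbF mul0r.
have low_u : low u.
  move=> i; rewrite leq_eqVlt => /orP[/eqP ki|ki].
    have -> : i = i0 by apply: val_inj.
    by rewrite !mxE !eqxx mulr1 subrr.
  rewrite !mxE v_low // (_ : (i == i0) = false) ?andbF ?mulr0 ?subr0 //.
  by apply/eqP => ii0; rewrite ii0 ltnn in ki.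
have vE : v = u + t *: e by rewrite subrK.
have -> : dotv (gamma + (a - gamma 0 i0) *: e) v = dotv gamma u + t * a.
  rewrite dotvC dotvDr dotvZr !(dotvC v) dote -/t {1}vE dotvDr dotvZr.
  by rewrite (dotvC gamma e) dote; ring.
(* Rescaling by the inverse of [|t|] brings the cone element over [u - e] or [u + e], according to
   the sign of [t]. *)
have [t0|t0|t0] := ltgtP t 0.
- have nt0 : 0 < - t by rewrite oppr_gt0.
  have : (- t)^-1 * (dotv gamma u - r) <= a.
    apply: ub_le_sup => //; exists ((- t)^-1 *: u), ((- t)^-1 * r); split.
    + exact: lowZ.
    + have := CZ (- t)^-1 _ _ _ Cvr; rewrite invr_gt0 => /(_ nt0).
      rewrite {1}vE scalerDr scalerA invrN mulNr mulVf ?lt_eqF //.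
      by rewrite scaleN1r.
    + by rewrite dotvZr mulrBr.
  by rewrite ler_pdivrMl //; lra.
- have : a <= t^-1 * (r - dotv gamma u).
    rewrite mulrBr -dotvZr; apply: ge_sup => //; apply: S_le; first exact: lowZ.
    have := CZ t^-1 _ _ _ Cvr; rewrite invr_gt0 => /(_ t0).
    by rewrite {1}vE scalerDr scalerA mulVf ?gt_eqF // scale1r.
  by rewrite ler_pdivlMl //; lra.
- rewrite t0 mul0r addr0 gammaP //.
  by move: Cvr; rewrite {1}vE t0 scale0r addr0.
Qed.

(** This makes the cone below total: each direction [v] is a positive multiple of some [y - x] with
    [y] in [K]. *)
Lemma nbhs_ray (R : realType) (n : nat) (K : set 'rV[R]_n) (x v : 'rV[R]_n) :
  nbhs x K -> exists2 t : R, 0 < t & K (x + t *: v).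
Proof.
move=> Kx.
have xtv : (x + t *: v) @[t --> (0 : R)] --> x + (0 : R) *: v.
  by apply: cvgD; [exact: cvg_cst | apply: cvgZr_tmp; exact: cvg_id].
rewrite scale0r addr0 in xtv.
have : \forall t \near (0 : R), K (x + t *: v) := xtv _ Kx.
move=> /nbhs_ballP[e /= e0 he].
exists (e / 2); first by rewrite divr_gt0.
by apply: he; rewrite /ball /= sub0r normrN gtr0_norm ?divr_gt0//; lra.
Qed.

Lemma jensen_at_affine_minorant (R : realType) (n : nat) (K : set 'rV[R]_n)
    (x : 'rV[R]_n) (g : 'rV[R]_n -> R) : nbhs x K ->
  (forall (xs : 'I_n.+1 -> 'rV[R]_n) (lam : 'I_n.+1 -> R),
    (forall i, K (xs i)) -> convex_weights lam -> barycenter lam xs = x ->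
    0 <= \sum_i lam i * g (xs i)) ->
  exists gamma : 'rV[R]_n, forall y, K y -> dotv gamma (y - x) <= g y.
Proof.
move=> Kx jensen_g.
(* The cone generated by the pairs [(y - x, g y)]. Finite lists of weighted points encode its
   elements, so that addition is concatenation. *)
pose C (v : 'rV[R]_n) (r : R) := exists2 s : seq (R * 'rV[R]_n),
  (forall p, p \in s -> 0 <= p.1 /\ K p.2) &
  \sum_(p <- s) p.1 *: (p.2 - x) = v /\ \sum_(p <- s) p.1 * g p.2 = r.
have [||||gamma gammaP] := @cone_linear_minorant R n C.
- move=> _ _ _ _ [s s_ok [<- <-]] [s' s'_ok [<- <-]].
  exists (s ++ s'); last by rewrite !big_cat.
  by move=> p; rewrite mem_cat => /orP[/s_ok|/s'_ok].
- move=> t _ _ t_gt0 [s s_ok [<- <-]].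
  exists [seq (t * p.1, p.2) | p <- s].
    by move=> _ /mapP[p /s_ok[p1 p2] ->]; split=> //; rewrite mulr_ge0 // ltW.
  rewrite !big_map scaler_sumr mulr_sumr.
  by split; apply: eq_bigr => p _; rewrite (scalerA, mulrA).
- move=> v.
  have [t t_gt0 Kt] : exists2 t : R, 0 < t & K (x + t *: v).
    exact: nbhs_ray.
  exists (t^-1 * g (x + t *: v)), [:: (t^-1, x + t *: v)].
    by move=> p; rewrite inE => /eqP -> /=; rewrite invr_ge0 ltW.
  by rewrite !big_seq1 /= addrC addKr scalerA mulVf ?gt_eqF // scale1r.
- move=> r [s s_ok [s0 <-]].
  exact: (jensen_cone jensen_g (nbhs_singleton Kx) s_ok s0).
exists gamma => y Ky; apply: gammaP.
exists [:: (1, y)]; last by rewrite !big_seq1 scale1r mul1r.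
by move=> p; rewrite inE => /eqP ->.
Qed.

(** * Uniform convexity and Jensen's inequality, at a point and on [K] *)

Section convexity_at_a_point.
Variables (R : realType) (n : nat) (K : set 'rV[R]_n) (sigma : R -> R).
Variable (f : 'rV[R]_n -> R).

Lemma uniformly_convex_at_jensen x gamma :
  uniformly_convex_at K sigma f x gamma -> jensen_convex_at K sigma f x.
Proof.
move=> f_convex xs lam Kxs [lam_ge0 lam1] lamx.
rewrite /jensen_convex lamx.
have : \sum_i lam i * (f x + sigma (enorm (x - xs i)) + dotv gamma (xs i - x)) <=
    \sum_i lam i * f (xs i).
  by apply: ler_sum => i _; rewrite ler_wpM2l // enormB f_convex.
under eq_bigr do rewrite !mulrDr -dotvZr scalerBr.
rewrite !big_split /= -mulr_suml lam1 mul1r -dotv_sumr sumrB -/(barycenter _ _).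
rewrite lamx -scaler_suml lam1 scale1r subrr dotv0r; lra.
Qed.

Lemma jensen_uniformly_convex_at x : nbhs x K ->
  jensen_convex_at K sigma f x ->
  exists gamma, uniformly_convex_at K sigma f x gamma.
Proof.
move=> Kx f_jensen.
have [|gamma gammaP] := @jensen_at_affine_minorant _ _ K x
    (fun y => f y - f x - sigma (enorm (y - x))) Kx.
  move=> xs lam Kxs lam_wgt lamx.
  have := f_jensen xs lam Kxs lam_wgt lamx; case: lam_wgt => lam_ge0 lam1.
  rewrite /jensen_convex lamx => jensen_x.
  under eq_bigr do rewrite !mulrBr (enormB _ x).
  by rewrite !sumrB -mulr_suml lam1 mul1r; lra.
by exists gamma => y /gammaP; lra.
Qed.

Lemma uniformly_convex_at_jensenP x : nbhs x K ->
  (exists gamma, uniformly_convex_at K sigma f x gamma) <->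
  jensen_convex_at K sigma f x.
Proof.
by move=> Kx; split=> [[gamma]|]; [exact: uniformly_convex_at_jensen|
  exact: jensen_uniformly_convex_at].
Qed.

(** [convex_set] speaks of two points only. The first point is split off and the other weights are
    renormalized by [1 - lam ord0], unless this is 0. *)
Lemma barycenter_in_convex m (xs : 'I_m -> 'rV[R]_n) (lam : 'I_m -> R) :
  convex_set K -> (forall i, K (xs i)) -> convex_weights lam ->
  K (barycenter lam xs).
Proof.
move=> convexK; elim: m xs lam => [|m IHm] xs lam Kxs [lam_ge0 lam1].
  by move: lam1; rewrite big_ord0 => /esym/eqP; rewrite oner_eq0.
rewrite /barycenter big_ord_recl.
have lam01 : 0 <= lam ord0 <= 1.
  by rewrite lam_ge0 -lam1 big_ord_recl lerDl sumr_ge0.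
have [lam0_1|lam0_neq1] := eqVneq (lam ord0) 1.
  have lamS0 i : lam (lift ord0 i) = 0.
    have : \sum_(i < m) lam (lift ord0 i) = 0.
      by move: lam1; rewrite big_ord_recl lam0_1; lra.
    by move/psumr_eq0P; apply.
  rewrite lam0_1 scale1r big1 ?addr0 // => i _.
  by rewrite lamS0 scale0r.
have lam0C_gt0 : 0 < 1 - lam ord0.
  by rewrite subr_gt0 lt_neqAle lam0_neq1; case/andP: lam01.
pose q := \sum_(i < m) ((1 - lam ord0)^-1 * lam (lift ord0 i)) *: xs (lift ord0 i).
have Kq : K q.
  apply: (IHm (fun i => xs (lift ord0 i))
    (fun i => (1 - lam ord0)^-1 * lam (lift ord0 i))) => //.
  split=> [i|]; first by rewrite mulr_ge0 // invr_ge0 ltW.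
  rewrite -mulr_sumr (_ : \sum_i _ = 1 - lam ord0) ?mulVf ?gt_eqF //.
  by move: lam1; rewrite big_ord_recl; lra.
have := convexK (xs ord0) q (Itv01 (proj1 (andP lam01)) (proj2 (andP lam01))).
rewrite !inE => /(_ (Kxs _) Kq).
have -> : \sum_(i < m) lam (lift ord0 i) *: xs (lift ord0 i) =
    (1 - lam ord0) *: q.
  rewrite scaler_sumr; apply: eq_bigr => i _.
  by rewrite scalerA mulrA mulfV ?gt_eqF // mul1r.
exact.
Qed.


Lemma uniformly_convex_on_jensenP : open K -> convex_set K ->
  uniformly_convex_on K sigma f <-> jensen_convex_on K sigma f.
Proof.
move=> openK convexK; split=> [[gamma gammaP] xs lam Kxs lam_wgt|f_jensen].
  have Kx := barycenter_in_convex convexK Kxs lam_wgt.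
  exact: (uniformly_convex_at_jensen (gammaP _ Kx)).
have /choice[gamma gammaP] : forall x, exists gamma, K x ->
    uniformly_convex_at K sigma f x gamma.
  (* Outside [K] the value 0 is a mere default. *)
  move=> x; have [Kx|nKx] := pselect (K x); last by exists 0.
  have [||gamma gammaP] := @jensen_uniformly_convex_at x.
  - exact: open_nbhs_nbhs.
  - by move=> xs lam Kxs lam_wgt _; exact: f_jensen.
  - by exists gamma.
by exists gamma.
Qed.

End convexity_at_a_point.

(** * Local Lipschitz continuity of uniformly convex functions *)

Lemma locally_lipschitz_near0 (R : realType) (sigma : R -> R) : sigma 0 = 0 ->
  locally_lipschitz_on (fun t : R => `|t|) setT sigma ->
  exists e L : R, [/\ 0 < e, 0 <= L & forall t, `|t| < e -> `|sigma t| <= L * `|t|].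
Proof.
move=> sigma0 /(_ 0 I)[U /nbhs_ballP[e /= e_gt0 eU] [L LP]].
exists e, `|L|; split => // t te.
have Ut : U t by apply: eU; rewrite /ball /= sub0r normrN.
have U0 : U 0 by apply: eU; rewrite /ball /= subrr normr0.
have := LP t 0 (conj Ut I) (conj U0 I); rewrite sigma0 !subr0 => /le_trans; apply.
by rewrite ler_wpM2r // ler_norm.
Qed.

(** The point is to bound [gamma y] uniformly for [y] near [a]. There [f] is bounded below by the
    convexity inequality at [a], and it is bounded above on the finitely many vertices of a cube
    around [a]; the inequality at [y], tested at a suitable vertex, bounds the sum of the absolute
    values of the coordinates of [gamma y]. *)
Lemma uniformly_convex_locally_lipschitz (R : realType) (n : nat)
    (K : set 'rV[R]_n) (sigma : R -> R) (f : 'rV[R]_n -> R) :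
  open K -> sigma 0 = 0 ->
  locally_lipschitz_on (fun t : R => `|t|) setT sigma ->
  uniformly_convex_on K sigma f -> locally_lipschitz_on (@enorm R n) K f.
Proof.
move=> openK sigma0 /(locally_lipschitz_near0 sigma0)[e [L [e_gt0 L_ge0 sigmaL]]].
move=> [gamma gammaP] a Ka.
have /nbhs_ballP[d /= d_gt0 dK] : nbhs a K by exact: open_nbhs_nbhs.
(* The bound [d / 2] keeps the cube inside [K]. The other one gives vectors of sup norm at most
   [3 r / 2], such as vertex minus [y], Euclidean norm below [e], because
   [n * (3 / 2) / (2 * (n + 1)) < 1]. *)
pose r := Num.min (d / 2) (e / (2 * n.+1%:R)).
have r_gt0 : 0 < r by rewrite lt_min !divr_gt0 // mulr_gt0.
have rd : r < d by rewrite gt_min; apply/orP; left; lra.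
have small (u : 'rV[R]_n) : `|u| <= r * (3 / 2) -> enorm u < e.
  move=> ur; apply: le_lt_trans (ler_enorm_norm u) _.
  apply: (@le_lt_trans _ _ (n%:R * ((e / (2 * n.+1%:R)) * (3 / 2)))).
    rewrite ler_wpM2l //; apply: le_trans ur _.
    by rewrite ler_wpM2r // ge_min lexx orbT.
  rewrite -natr1; have : 0 <= n%:R :> R by [].
  set N : R := n%:R => N_ge0.
  rewrite (_ : _ * _ = e * (3 / 4) * (N / (N + 1))); last by field; lra.
  have : N / (N + 1) < 1 by rewrite ltr_pdivrMr; lra.
  nra.
pose x (s : {ffun 'I_n -> bool}) : 'rV[R]_n := a + r *: \row_i (-1) ^+ s i.
have norm_sign (s : {ffun 'I_n -> bool}) : `|\row_i (-1) ^+ s i : 'rV[R]_n| <= 1.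
  rewrite [leLHS]mx_normrE; apply/bigmax_leP; split => // -[i j] _ /=.
  by rewrite mxE normrX normrN1 expr1n.
have Kx s : K (x s).
  apply: dK; rewrite -ball_normE /ball_ /= opprD addNKr normrN normrZ gtr0_norm //.
  by apply: le_lt_trans rd; rewrite ler_piMr // ltW.
have sigma_small (u : 'rV[R]_n) : `|u| <= r * (3 / 2) ->
    `|sigma (enorm u)| <= L * enorm u.
  move=> /small ue; have := sigmaL (enorm u).
  by rewrite ger0_norm ?enorm_ge0 //; apply.
pose Y := ball a (r / 2).
have YK y : Y y -> K y.
  by move=> Yy; apply: dK; apply: le_ball Yy; lra.
pose Ga := \sum_i `|gamma a 0 i|.
have f_lower y : Y y -> f a - L * e - Ga * e <= f y.
  move=> Yy; have := gammaP a Ka y (YK _ Yy).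
  have ya : `|y - a| <= r * (3 / 2).
    by move: Yy; rewrite /Y -ball_normE /= distrC; lra.
  have := sigma_small _ ya; rewrite ler_norml => /andP[+ _].
  have := ler_dotv_sum_enorm (gamma a) (y - a); rewrite ler_norml -/Ga => /andP[+ _].
  have : L * enorm (y - a) <= L * e by rewrite ler_wpM2l // ltW // small.
  have : Ga * enorm (y - a) <= Ga * e by rewrite ler_wpM2l ?sumr_ge0 // ltW // small.
  lra.
pose M := \sum_s `|f (x s)|.
pose G := (2 / r) * (M + L * e - (f a - L * e - Ga * e)).
have gamma_le y : Y y -> \sum_i `|gamma y 0 i| <= G.
  (* The vertex [x s] has the signs of [gamma y]. Each coordinate then contributes at least
     [r - r / 2] times its absolute value to the inner product, since [y] is within [r / 2] of
     [a]. *)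
  move=> Yy; pose s : {ffun 'I_n -> bool} := [ffun i => gamma y 0 i < 0].
  have yar : `|a - y| < r / 2 by move: Yy; rewrite /Y -ball_normE.
  have xsy : `|x s - y| <= r * (3 / 2).
    rewrite /x addrAC; apply: le_trans (ler_normD _ _) _.
    have : `|r *: (\row_i (-1) ^+ s i : 'rV[R]_n)| <= r.
      by rewrite normrZ gtr0_norm // ler_piMr // ltW.
    lra.
  have dot_ge : r / 2 * \sum_i `|gamma y 0 i| <= dotv (gamma y) (x s - y).
    rewrite mulr_sumr; apply: ler_sum => i _; rewrite !mxE ffunE.
    rewrite addrAC mulrDr mulrCA [gamma y 0 i * (-1) ^+ _]mulrC -normrEsign.
    have := ler_coord_norm (a - y) i; rewrite !mxE => ayi.
    have : `|gamma y 0 i * (a 0 i - y 0 i)| <= `|gamma y 0 i| * (r / 2).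
      by rewrite normrM ler_wpM2l // (le_trans ayi) // ltW.
    rewrite ler_norml => /andP[+ _]; lra.
  have := gammaP y (YK _ Yy) (x s) (Kx s).
  have := sigma_small _ xsy; rewrite ler_norml => /andP[+ _].
  have : L * enorm (x s - y) <= L * e by rewrite ler_wpM2l // ltW // small.
  have : f (x s) <= M.
    rewrite /M (bigD1 s) //=; apply: le_trans (ler_norm _) _.
    by rewrite lerDl sumr_ge0.
  have := f_lower y Yy; move: dot_ge.
  move=> *; rewrite -(ler_pM2l (_ : 0 < r / 2)) ?divr_gt0 // /G mulrA.
  rewrite (_ : r / 2 * (2 / r) = 1) ?mul1r; last by field; rewrite gt_eqF.
  lra.
exists Y; first by apply: nbhsx_ballx; rewrite divr_gt0.
exists (L + G) => y z [Yy _] [Yz _].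
(* One-sided bounds suffice by symmetry, and the inequality at [y] tested at [z] bounds [f y - f z]
   from above. *)
wlog suff : y z Yy Yz / f y - f z <= (L + G) * enorm (y - z).
  move=> h; rewrite ler_norml h // andbT lerNl opprB enormB.
  exact: h.
have yz : `|z - y| <= r * (3 / 2).
  move: Yy Yz; rewrite /Y -ball_normE /= => ay az.
  have := ler_normD (z - a) (a - y); rewrite subrKA (distrC z a); lra.
have := gammaP y (YK _ Yy) z (YK _ Yz).
have := sigma_small _ yz; rewrite ler_norml => /andP[+ _].
have := ler_dotv_sum_enorm (gamma y) (z - y); rewrite ler_norml => /andP[+ _].
have : (\sum_i `|gamma y 0 i|) * enorm (z - y) <= G * enorm (z - y).
  by rewrite ler_wpM2r ?enorm_ge0 // gamma_le.
rewrite (enormB y z); lra.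
Qed.

(** * Measurability of functions of random vectors, and continuous functions on segments *)

Section borel_vectors.
Variables (R : realType) (n : nat) (d : measure_display) (T : measurableType d).
Implicit Types (X : T -> borel_rV R n) (B : set 'rV[R]_n).

Lemma measurable_preimage_open X B : measurable_fun setT X -> open B ->
  measurable (X @^-1` B).
Proof.
move=> mX oB; rewrite -[X in measurable X]setTI; apply: mX => //.
exact: sub_sigma_algebra.
Qed.

(** Values of [f] off [K] are arbitrary, so superlevel sets are first intersected with [K], where
    [X] takes its values; these intersections are open. *)
Lemma measurable_comp_continuous_in (K : set 'rV[R]_n) (f : 'rV[R]_n -> R) X :
  (forall x, K x -> {for x, continuous f}) -> open K -> measurable_fun setT X ->
  (forall w, K (X w)) -> measurable_fun setT (fun w => f (X w)).
Proof.
move=> f_cont openK mX KX.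
apply: (measurability _ (RGenOInfty.measurableE R)) => _ [_ [a ->]] <-.
rewrite setTI (_ : _ @^-1` _ = X @^-1` (K `&` [set x | a < f x])); last first.
  apply/seteqP; split => w /=; rewrite in_itv /= andbT; first by split.
  by case.
apply: measurable_preimage_open => //; rewrite openE => x [Kx afx].
apply: filterI; first exact: open_nbhs_nbhs.
have fx : nbhs (f x) [set z | a < z].
  by apply: open_nbhs_nbhs; split => //; exact: open_gt.
exact: (f_cont x Kx _ fx).
Qed.

Lemma measurable_coordinate X i : measurable_fun setT X ->
  measurable_fun setT (coordinate X i).
Proof.
move=> mX; apply: (@measurable_comp_continuous_in setT (fun x => x 0 i)) => //.
  by move=> x _; exact: coord_continuous.
exact: openT.
Qed.

Lemma measurable_enormB X0 X1 : measurable_fun setT X0 -> measurable_fun setT X1 ->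
  measurable_fun setT (fun w => enorm ((X0 w : 'rV[R]_n) - X1 w)).
Proof.
move=> mX0 mX1; rewrite /enorm.
apply: (@measurableT_comp _ _ _ _ _ _ (@Num.sqrt R)).
  by apply: continuous_measurable_fun; exact: sqrt_continuous.
apply: measurable_sum => i; rewrite (_ : (fun w => _) = fun w =>
  (coordinate X0 i w - coordinate X1 i w) * (coordinate X0 i w - coordinate X1 i w)).
  by apply: measurable_funM; apply: measurable_funB; exact: measurable_coordinate.
by apply/funext => w; rewrite !mxE.
Qed.

End borel_vectors.

Lemma continuous_bounded_segment (R : realType) (sigma : R -> R) (B : R) :
  continuous sigma -> exists M, forall t, 0 <= t <= B -> `|sigma t| <= M.
Proof.
move=> sigma_cont.
have [B_lt0|B_ge0] := ltP B 0.
  by exists 0 => t /andP[/le_trans h /h]; rewrite leNgt B_lt0.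
have abs_cont : {within `[0, B], continuous (fun t => `|sigma t|)}.
  by apply: continuous_subspaceT => t; apply: cvg_norm; exact: sigma_cont.
by have [c _ cP] := EVT_max B_ge0 abs_cont; exists `|sigma c| => t t0B; exact: cP.
Qed.

(** A form of Heine's theorem in which only [s] is confined to the segment: in the application [t]
    is the distance to a cell center and may leave it. Compactness is used through near coverings,
    with [d] tending to 0 from the right. *)
Lemma continuous_uniformly_segment (R : realType) (sigma : R -> R) (B e : R) :
  continuous sigma -> 0 < e -> exists2 d, 0 < d & forall s t,
    0 <= s <= B -> `|t - s| < d -> `|sigma t - sigma s| < e.
Proof.
move=> sigma_cont e_gt0.
have near2 (a b c r : R) : `|a - b| < r / 2 -> `|c - b| < r / 2 -> `|a - c| < r.
  by have := ler_normD (a - b) (b - c); rewrite subrKA (distrC b c); lra.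
have /compact_near_coveringP covering := @segment_compact R 0 B.
have := covering R (0^'+) (fun d s => 0 < d -> forall t,
    `|t - s| < d -> `|sigma t - sigma s| < e) _.
case.
- move=> s _.
  have /nbhs_ballP[r /= r_gt0 rP] : \forall t \near s, `|sigma s - sigma t| < e / 2.
    by have /cvgrPdist_lt := sigma_cont s; apply; rewrite divr_gt0.
  exists (ball s (r / 2), [set d | d < r / 2]) => /=.
    split; first by apply: nbhsx_ballx; rewrite divr_gt0.
    by apply: nbhs_right_lt; rewrite divr_gt0.
  move=> [s' d] [/= ss' dr] d_gt0 t ts'.
  have hs' : `|sigma s - sigma s'| < e / 2.
    by apply: rP; apply: le_ball ss'; lra.
  have ht : `|sigma s - sigma t| < e / 2.
    by apply: rP; apply: (near2 s s' t) => //; exact: lt_trans ts' dr.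
  by rewrite distrC in ht; apply: (near2 _ (sigma s)) => //; rewrite distrC.
- move=> d /= d_gt0 dP; exists (d / 2); first by rewrite divr_gt0.
  move=> s t s0B ts; apply: (dP (d / 2)) => //; rewrite ?divr_gt0 //.
  by rewrite /ball /= sub0r normrN gtr0_norm ?divr_gt0 //; lra.
Qed.

(** * Comparison of integrals that may be infinite *)

Lemma leeD_of_subr (R : realDomainType) (a b c e : \bar R) :
  (0 <= a)%E -> (0 <= b)%E -> (a < +oo)%E -> c \is a fin_num -> e \is a fin_num ->
  (a - b <= c - e)%E -> (a + e <= b + c)%E.
Proof.
case: a b c e => [a| |] [b| |] [c| |] [e| |] //= _ _ _ _ _.
  by rewrite -!EFinD !lee_fin; lra.
by rewrite leey.
Qed.

Lemma lee_subr_of_add (R : realDomainType) (a b c e : \bar R) :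
  (0 <= a)%E -> (0 <= b)%E -> (a < +oo)%E \/ (b < +oo)%E ->
  c \is a fin_num -> e \is a fin_num ->
  (a + e <= b + c)%E -> (a - b <= c - e)%E.
Proof.
case: a b c e => [a| |] [b| |] [c| |] [e| |] //= _ _ [|] // _ _ _.
all: try by rewrite leNye.
all: by rewrite -!EFinD !lee_fin; lra.
Qed.

Section integral_comparison.
Variables (R : realType) (d : measure_display) (T : measurableType d).
Variable mu : {measure set T -> \bar R}.
Local Open Scope ereal_scope.

(** An integrable upper bound controls the positive part of [Y]; the negative part may have infinite
    integral, so the two parts are compared separately. *)
Lemma le_integral_integrable (D : set T) (Y S : T -> R) : measurable D ->
  measurable_fun D Y -> mu.-integrable D (EFin \o S) ->
  (forall w, D w -> (Y w <= S w)%R) ->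
  \int[mu]_(w in D) (EFin \o Y)^\+ w < +oo /\
  \int[mu]_(w in D) (Y w)%:E <= \int[mu]_(w in D) (S w)%:E.
Proof.
move=> mD mY iS YS.
have mS := measurable_int mu iS.
have mY' : measurable_fun D (EFin \o Y) by exact/measurable_EFinP.
have YS' : {in D, forall w, (EFin \o Y) w <= (EFin \o S) w}.
  by move=> w; rewrite inE => Dw; rewrite /= lee_fin YS.
have Ypos : \int[mu]_(w in D) (EFin \o Y)^\+ w <=
    \int[mu]_(w in D) (EFin \o S)^\+ w.
  apply: ge0_le_integral => //.
  - exact: measurable_funepos.
  - exact: measurable_funepos.
  - by move=> w Dw; apply: (funepos_le YS'); rewrite inE.
have Yneg : \int[mu]_(w in D) (EFin \o S)^\- w <=
    \int[mu]_(w in D) (EFin \o Y)^\- w.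
  apply: ge0_le_integral => //.
  - exact: measurable_funeneg.
  - exact: measurable_funeneg.
  - by move=> w Dw; apply: (funeneg_le YS'); rewrite inE.
split.
  apply: le_lt_trans Ypos _; rewrite ltey_eq.
  by rewrite integrable_pos_fin_num.
by rewrite integralE [leRHS]integralE leeB.
Qed.

(** The functions [D j] need not be jointly integrable over all cells, so they are removed cell by
    cell. The resulting inequality is put in the additive form [Y^+ + S^- <= Y^- + S^+] of integrals
    of nonnegative functions, which sums over countably many cells; the finiteness assumption on [Y]
    allows the subtraction at the end. *)
Lemma le_integral_cells (A : (set T)^nat) (Y S : T -> R) (D : nat -> T -> R) :
  (forall j, measurable (A j)) -> trivIset setT A -> \bigcup_j A j = setT ->
  measurable_fun setT Y -> mu.-integrable setT (EFin \o S) ->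
  (forall j, mu.-integrable (A j) (EFin \o D j)) ->
  (forall j, \int[mu]_(w in A j) (D j w)%:E = 0) ->
  (forall j w, A j w -> (Y w + D j w <= S w)%R) ->
  \int[mu]_w (EFin \o Y)^\+ w < +oo \/ \int[mu]_w (EFin \o Y)^\- w < +oo ->
  \int[mu]_w (Y w)%:E <= \int[mu]_w (S w)%:E.
Proof.
move=> mA trivA coverA mY iS iD intD0 YS Yfin.
have mS := measurable_int mu iS.
have mY' : measurable_fun setT (EFin \o Y) by exact/measurable_EFinP.
have mYp : measurable_fun setT (EFin \o Y)^\+ by exact: measurable_funepos.
have mYn : measurable_fun setT (EFin \o Y)^\- by exact: measurable_funeneg.
have mSp : measurable_fun setT (EFin \o S)^\+ by exact: measurable_funepos.
have mSn : measurable_fun setT (EFin \o S)^\- by exact: measurable_funeneg.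
have Sp_fin := integrable_pos_fin_num measurableT iS.
have Sn_fin := integrable_neg_fin_num measurableT iS.
have cell j : \int[mu]_(w in A j) ((EFin \o Y)^\+ w + (EFin \o S)^\- w) <=
    \int[mu]_(w in A j) ((EFin \o Y)^\- w + (EFin \o S)^\+ w).
  have iSj : mu.-integrable (A j) (EFin \o S).
    exact: integrableS measurableT (mA j) (@subsetT _ _) iS.
  have iSDj : mu.-integrable (A j) (EFin \o (S \- D j)%R).
    by rewrite (_ : _ \o _ = (EFin \o S) \- (EFin \o D j)) //; exact: integrableB.
  have [||||Yp_fin] := @le_integral_integrable (A j) Y (S \- D j)%R.
  - exact: mA.
  - exact: measurable_funS mY.
  - exact: iSDj.
  - by move=> w Ajw; have := YS j w Ajw; rewrite /=; lra.
  have -> : \int[mu]_(w in A j) ((S \- D j)%R w)%:E = \int[mu]_(w in A j) (S w)%:E.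
    rewrite (_ : (fun w => _) = (EFin \o S) \- (EFin \o D j)) // integralB //.
    by rewrite intD0 sube0.
  rewrite integralE [leRHS]integralE => YSj.
  rewrite !ge0_integralD //; try exact: measurable_funS measurableT (@subsetT _ _) _.
  apply: leeD_of_subr YSj => //; try exact: integral_ge0.
  - exact: integrable_pos_fin_num.
  - exact: integrable_neg_fin_num.
have total : \int[mu]_w ((EFin \o Y)^\+ w + (EFin \o S)^\- w) <=
    \int[mu]_w ((EFin \o Y)^\- w + (EFin \o S)^\+ w).
  rewrite -coverA !ge0_integral_bigcup //.
  - apply: lee_nneseries => [j _ _|j _]; last exact: cell.
    by apply: integral_ge0 => w _; exact: adde_ge0.
  - by rewrite coverA; exact: emeasurable_funD.
  - by move=> w _; exact: adde_ge0.
  - by rewrite coverA; exact: emeasurable_funD.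
  - by move=> w _; exact: adde_ge0.
rewrite !ge0_integralD // in total; rewrite integralE [leRHS]integralE.
by apply: lee_subr_of_add => //; exact: integral_ge0.
Qed.

End integral_comparison.

(** * Countable subcovers by rational balls *)

Lemma rat_row_dense (R : realType) (n : nat) (x : 'rV[R]_n) (e : R) : 0 < e ->
  exists q : 'rV[rat]_n, ball (map_mx ratr q : 'rV[R]_n) e x.
Proof.
move=> e_gt0.
have /choice[q qP] : forall i : 'I_n, exists q : rat, `|ratr q - x 0 i| < e.
  move=> i; have [|q] := @rat_in_itvoo R (x 0 i - e) (x 0 i + e); first lra.
  by rewrite in_itv /= => h; exists q; rewrite ltr_norml; lra.
exists (\row_i q i); split => // i j; rewrite !mxE ord1; exact: qP.
Qed.

(** Lindelof's argument: to each rational ball lying in some [U a'] with [a'] in [K], one such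
    center is assigned. The point [x0] of [K] serves for the other balls and for indices that encode
    no ball. *)
Lemma countable_subcover (R : realType) (n : nat) (K : set 'rV[R]_n)
    (U : 'rV[R]_n -> set 'rV[R]_n) : K !=set0 ->
  (forall x, K x -> nbhs x (U x)) ->
  exists a : nat -> 'rV[R]_n, (forall j, K (a j)) /\ K `<=` \bigcup_j U (a j).
Proof.
move=> [x0 Kx0] nbhsU.
pose B (p : 'rV[rat]_n * nat) : set 'rV[R]_n :=
  ball (map_mx ratr p.1 : 'rV[R]_n) p.2.+1%:R^-1.
have /choice[c cP] : forall p, exists a, K a /\
    ((exists2 a', K a' & B p `<=` U a') -> B p `<=` U a).
  move=> p; have [[a' Ka' BU]|nBU] := pselect (exists2 a', K a' & B p `<=` U a').
    by exists a'.
  by exists x0.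
exists (fun j => if unpickle j is Some p then c p else x0); split.
  by move=> j; case: unpickle => // p; case: (cP p).
move=> x Kx; have /nbhs_ballP[e /= e_gt0 eU] := nbhsU x Kx.
(* A ball of radius below [e / 2] that contains [x] lies in the ball of radius [e] around [x]. *)
have [k ke] : exists k : nat, k.+1%:R^-1 < e / 2.
  have e2 : 0 < e / 2 by rewrite divr_gt0.
  have [k _ /(_ k (leqnn k))] := near_infty_natSinv_lt (PosNum e2).
  by exists k.
have k_gt0 : 0 < k.+1%:R^-1 :> R by rewrite invr_gt0.
have [q qx] := rat_row_dense x k_gt0.
exists (pickle (q, k)) => //; rewrite pickleK.
have [_ cU] := cP (q, k); apply: cU => //; exists x => // y qy; apply: eU.
apply: (@le_ball _ _ _ (k.+1%:R^-1 + k.+1%:R^-1)).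
  by rewrite [leRHS]splitr lerD // ltW.
by apply: ball_triangle qy; apply: ball_sym.
Qed.

(** * Integrability for bounded random vectors *)

Section bounded_random_vectors.
Variables (R : realType) (n : nat) (d : measure_display) (T : measurableType d).
Variable P : probability T R.
Implicit Types X : T -> borel_rV R n.

Lemma bounded_integrable (A : set T) (Y : T -> R) (M : R) : measurable A ->
  measurable_fun setT Y -> (forall w, `|Y w| <= M) ->
  P.-integrable A (EFin \o Y).
Proof.
move=> mA mY YM; apply: measurable_bounded_integrable => //.
- exact: le_lt_trans (probability_le1 P mA) (ltry _).
- exact: measurable_funS mY.
- exists M; split; first exact: num_real.
  by move=> N MN w _ /=; apply: le_trans (YM w) _; exact: ltW.
Qed.

Lemma integrable_coordinate X (A : set T) i : measurable A ->
  measurable_fun setT X -> bounded_rv X ->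
  P.-integrable A (EFin \o coordinate X i).
Proof.
move=> mA mX [M XM]; apply: (@bounded_integrable _ _ M) => //.
  exact: measurable_coordinate.
by move=> w; apply: le_trans (XM w); exact: ler_coord_enorm.
Qed.

Lemma enormB_bounded X0 X1 : bounded_rv X0 -> bounded_rv X1 ->
  exists B, forall w, 0 <= enorm ((X0 w : 'rV[R]_n) - X1 w) <= B.
Proof.
move=> [M0 XM0] [M1 XM1]; exists (M0 + M1) => w; rewrite enorm_ge0 /=.
apply: le_trans (ler_enormD _ _) _; rewrite enormN; exact: lerD.
Qed.

Lemma integrable_sigma_enormB (sigma : R -> R) X0 X1 : continuous sigma ->
  measurable_fun setT X0 -> measurable_fun setT X1 ->
  bounded_rv X0 -> bounded_rv X1 ->
  P.-integrable setT (EFin \o (fun w => sigma (enorm ((X0 w : 'rV[R]_n) - X1 w)))).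
Proof.
move=> sigma_cont mX0 mX1 bX0 bX1.
have [B XB] := enormB_bounded bX0 bX1.
have [M sigmaM] := continuous_bounded_segment B sigma_cont.
apply: (@bounded_integrable _ _ M) => //; last by move=> w; exact: sigmaM.
apply: measurableT_comp; last exact: measurable_enormB.
exact: continuous_measurable_fun.
Qed.

(** Linearity over coordinates makes the linear term disappear. It is applied with [A] the whole
    space and [X0] constant for means, and with [A] an event determined by [X0] for martingales. *)
Lemma integral_dotvB_eq0 (v : 'rV[R]_n) X0 X1 (A : set T) : measurable A ->
  measurable_fun setT X0 -> measurable_fun setT X1 ->
  bounded_rv X0 -> bounded_rv X1 ->
  (forall i, \int[P]_(w in A) (coordinate X1 i w)%:E =
             \int[P]_(w in A) (coordinate X0 i w)%:E)%E ->
  P.-integrable A (EFin \o (fun w => dotv v ((X1 w : 'rV[R]_n) - X0 w))) /\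
  (\int[P]_(w in A) (dotv v ((X1 w : 'rV[R]_n) - X0 w))%:E = 0)%E.
Proof.
move=> mA mX0 mX1 bX0 bX1 X01.
pose F i : T -> \bar R := fun w =>
  ((v 0 i)%:E * ((coordinate X1 i w)%:E - (coordinate X0 i w)%:E))%E.
have iB i : P.-integrable A
    ((EFin \o coordinate X1 i) \- (EFin \o coordinate X0 i))%E.
  by apply: integrableB => //; exact: integrable_coordinate.
have iF i : P.-integrable A (F i) by exact: (integrableZl mA (v 0 i) (iB i)).
have dotE w : (dotv v ((X1 w : 'rV[R]_n) - X0 w))%:E = (\sum_i F i w)%E.
  rewrite /dotv -sumEFin; apply: eq_bigr => i _.
  by rewrite /F /coordinate !mxE EFinM EFinB.
split.
  apply: (eq_integrable mA (fun w => (\sum_i F i w)%E)).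
    by move=> w _; rewrite /= dotE.
  exact: integrable_sum.
under eq_integral do rewrite dotE.
rewrite integral_sum // big1 // => i _.
have i1 := integrable_coordinate i mA mX1 bX1.
have i0 := integrable_coordinate i mA mX0 bX0.
rewrite /F (integralZl mA (iB i)) (integralB mA i1 i0) X01 subee ?mule0 //.
exact: integrable_fin_num.
Qed.

End bounded_random_vectors.

(** Neighborhoods refer to the sup norm; the divisor [n.+1] rather than [n] also covers dimension
    0. *)
Lemma nbhs_enorm (R : realType) (n : nat) (a : 'rV[R]_n) (r : R) : 0 < r ->
  nbhs a [set x | enorm (x - a) < r].
Proof.
move=> r_gt0; apply/nbhs_ballP; exists (r / n.+1%:R) => /=; first exact: divr_gt0.
move=> x; rewrite -ball_normE /= => xa; apply: le_lt_trans (ler_enorm_norm _) _.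
apply: (@le_lt_trans _ _ (n.+1%:R * `|a - x|)).
  by rewrite distrC ler_wpM2r // ler_nat.
by rewrite -ltr_pdivlMl // mulrC.
Qed.

(** * From uniform convexity to inequalities between expectations *)

Section convex_to_martingale.
Variables (R : realType) (n : nat) (K : set 'rV[R]_n) (sigma : R -> R).
Variable f : 'rV[R]_n -> R.
Hypotheses (openK : open K) (sigma_cont : continuous sigma).
Hypothesis f_cont : forall x, K x -> {for x, continuous f}.

(** The vector [gamma] is fixed, so [f x - f (X w)] lies below the integrable function
    [- s w - D w], where [D] has integral 0; this also gives existence of the expectation. *)
Lemma uniformly_convex_mean x gamma : uniformly_convex_at K sigma f x gamma ->
  mean_convex_at K sigma f x.
Proof.
move=> f_convex d T P X KX bX Xx.
have mX : measurable_fun setT X by exact: measurable_funPT.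
pose X0 : T -> borel_rV R n := cst x.
have mX0 : measurable_fun setT X0 by exact: measurable_cst.
have bX0 : bounded_rv X0 by exists (enorm x).
pose s w := sigma (enorm (x - X w)); pose D w := dotv gamma ((X w : 'rV[R]_n) - x).
have iS : P.-integrable setT (EFin \o s).
  exact: (@integrable_sigma_enormB _ _ _ _ P sigma X0 X).
have [iD intD0] : P.-integrable setT (EFin \o D) /\ (\int[P]_w (D w)%:E = 0)%E.
  apply: (@integral_dotvB_eq0 _ _ _ _ P gamma X0 X) => // i.
  have := Xx i; rewrite unlock => ->.
  rewrite -[RHS]/(\int[P]_w cst (x 0 i)%:E w)%E integral_cst //=.
  by rewrite probability_setT mule1.
have mY : measurable_fun setT (fun w => f x - f (X w)).
  by apply: measurable_funB => //; apply: measurable_comp_continuous_in KX.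
have iSD : P.-integrable setT (EFin \o (fun w => - s w - D w)).
  rewrite (_ : _ \o _ = (\- (EFin \o s) \- (EFin \o D))%E) //.
  by apply: integrableB => //; exact: integrableN.
have [|Ypos YSD] := @le_integral_integrable _ _ _ P setT _ _ measurableT mY iSD.
  by move=> w _; have := f_convex (X w) (KX w); rewrite /s /D enormB; lra.
split; first by split => //; left.
rewrite unlock; apply: le_trans YSD _.
rewrite (_ : (fun w => _) = (\- (EFin \o s) \- (EFin \o D))%E) //.
rewrite integralB //; last exact: integrableN.
rewrite intD0 sube0 integralN //.
exact: integrable_add_def.
Qed.

Lemma uniformly_convex_martingale : uniformly_convex_on K sigma f ->
  martingale_convex K sigma f.
Proof.
move=> [gamma gammaP] d T P X0 X1 KX0 KX1 bX0 bX1 mart [mY Yfin].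
have mX0 : measurable_fun setT X0 by exact: measurable_funPT.
have mX1 : measurable_fun setT X1 by exact: measurable_funPT.
pose s w := sigma (enorm ((X0 w : 'rV[R]_n) - X1 w)).
have iS : P.-integrable setT (EFin \o s) by exact: integrable_sigma_enormB.
rewrite unlock; apply/lee_addgt0Pr => e e_gt0.
have e3_gt0 : 0 < e / 3 by rewrite divr_gt0.
have [B XB] := enormB_bounded bX0 bX1.
have [r r_gt0 sigma_r] := continuous_uniformly_segment B sigma_cont e3_gt0.
pose G a := \sum_i `|gamma a 0 i|.
have G_ge0 a : 0 <= G a by exact: sumr_ge0.
(* Replacing [X0] by the center [a] causes three errors of at most [e / 3]: in [f], in [sigma]
   through the radius [r], and in the linear term through the bound involving [G a]; the added 1
   keeps the divisor positive. *)
pose U a := [set x | `|f a - f x| < e / 3] `&`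
  [set x | enorm (x - a) < Num.min r (e / 3 / (G a + 1))].
have nbhsU a : K a -> nbhs a (U a).
  move=> Ka; apply: filterI; last first.
    by apply: nbhs_enorm; rewrite lt_min r_gt0 divr_gt0 // ltr_wpDl.
  by have /cvgrPdist_lt := f_cont Ka; apply.
have K0 : K !=set0 by exists (X0 point).
have [|a [Ka Kcover]] := @countable_subcover _ _ K (fun a => (U a)°) K0.
  by move=> a Ka; apply: nbhs_interior; exact: nbhsU.
(* Interiors are open, hence Borel, and [seqDU] makes the cells disjoint. *)
pose C j : set (borel_rV R n) := seqDU (fun j => (U (a j))° : set (borel_rV R n)) j.
have mC j : measurable (C j).
  apply: seqDU_measurable => i; apply: sub_sigma_algebra; exact: open_interior.
pose A j := X0 @^-1` C j.
have mA j : measurable (A j) by rewrite -[A j]setTI; exact: mX0.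
pose D j w := dotv (gamma (a j)) ((X1 w : 'rV[R]_n) - X0 w).
have DP j : P.-integrable (A j) (EFin \o D j) /\
    (\int[P]_(w in A j) (D j w)%:E = 0)%E.
  apply: integral_dotvB_eq0 => // i.
  (* [A j] is the preimage under [X0] of a Borel set, so the defining property of the conditional
     expectation applies on it. *)
  case: (mart i) => _ _ _ /(_ (A j)) ->//.
  by exists (C j) => //; rewrite setTI.
have eintE : (- (\int[P]_w (s w)%:E) + e%:E = \int[P]_w (e - s w)%R%:E)%E.
  rewrite (_ : (fun w => (e - s w)%R%:E) = (cst e%:E \- (EFin \o s))%E) //.
  rewrite integralB //; last exact: finite_measure_integrable_cst.
  by rewrite integral_cst //= probability_setT mule1 addeC.
rewrite eintE.
apply: (@le_integral_cells _ _ _ P A _ _ D) => //.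
- move=> i j _ _ [w [Ciw Cjw]].
  by apply: (@trivIset_seqDU _ (fun j => (U (a j))°)) => //; exists (X0 w).
- rewrite -preimage_bigcup -seqDU_bigcup_eq; apply/seteqP; split => // w _.
  exact: Kcover.
- rewrite (_ : _ \o _ = (cst e%:E \- (EFin \o s))%E) //.
  by apply: integrableB => //; exact: finite_measure_integrable_cst.
- by move=> j; case: (DP j).
- by move=> j; case: (DP j).
move=> j w [/interior_subset[/= fa]]; rewrite lt_min => /andP[ar aG] _.
have Gxa : `|dotv (gamma (a j)) ((X0 w : 'rV[R]_n) - a j)| <= e / 3.
  apply: le_trans (ler_dotv_sum_enorm _ _) _; rewrite -/(G _).
  move: aG; rewrite ltr_pdivlMr ?ltr_wpDl // => aG.
  have := enorm_ge0 ((X0 w : 'rV[R]_n) - a j); lra.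
have dist_r : `|enorm ((X1 w : 'rV[R]_n) - a j) -
    enorm ((X0 w : 'rV[R]_n) - X1 w)| < r.
  rewrite (enormB (X0 w)); apply: le_lt_trans (ler_enormB_dist _ _) _.
  by rewrite opprB addrC subrKA.
have := sigma_r _ _ (XB w) dist_r.
have := gammaP _ (Ka j) _ (KX1 w).
(* The first summand yields [D j w], of integral 0 over the cell, and the second is the error
   bounded by [Gxa]. *)
have -> : (X1 w : 'rV[R]_n) - a j = (X1 w - X0 w) + (X0 w - a j).
  by rewrite subrKA.
rewrite dotvDr -/(D j w) -/(s w).
move: fa Gxa; rewrite !ltr_norml !ler_norml => /andP[? ?] /andP[? ?] ? /andP[? ?].
lra.
Qed.

End convex_to_martingale.

(** * Finitely supported laws, and the return from expectations to Jensen's inequality *)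

Lemma measurable_fun_nat d (T : measurableType d) (h : nat -> T) :
  measurable_fun setT h.
Proof. by []. Qed.

(** The law is a weighted sum of Dirac masses on [nat], where every function is measurable.
    Nonnegative integrands come first; general ones follow by splitting into positive and negative
    parts. *)
Lemma weighted_dirac_law (R : realType) (m : nat) (lam : 'I_m.+1 -> R) :
  convex_weights lam -> exists Q : probability nat R, forall h : nat -> R,
    Q.-integrable setT (EFin \o h) /\
    (\int[Q]_k (h k)%:E = (\sum_i lam i * h i)%:E)%E.
Proof.
move=> [lam_ge0 lam1].
(* [inord] extends the weights to all naturals, but only indices up to [m] enter the sum of
   measures. *)
pose w (i : nat) : {nonneg R} := NngNum (lam_ge0 (inord i)).
pose mu : {measure set nat -> \bar R} :=
  msum (fun i => mscale (w i) \d_i) m.+1.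
have ge0_int (h : nat -> R) : (forall k, 0 <= h k) ->
    (\int[mu]_k (h k)%:E = (\sum_i lam i * h i)%:E)%E.
  move=> h_ge0; rewrite ge0_integral_measure_sum //; last first.
    by move=> k _; rewrite lee_fin.
  rewrite -sumEFin; apply: eq_bigr => i _.
  rewrite ge0_integral_mscale //; last by move=> k _; rewrite lee_fin.
  have mh : measurable_fun setT (EFin \o h) by exact: measurable_fun_nat.
  rewrite [X in (_ * X)%E](@integral_dirac _ _ (i : nat) R setT measurableT _ mh).
  by rewrite diracT mul1e /= inord_val EFinM.
have mu1 : mu setT = 1%E.
  rewrite -[LHS]mul1e -integral_cst // (ge0_int (cst 1)) //.
  by congr _%:E; rewrite -[RHS]lam1; apply: eq_bigr => i _; rewrite /= mulr1.
pose Q : probability nat R := HB.pack (Measure.sort mu) (Measure.class mu)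
  (Measure_isProbability.Build _ _ _ (Measure.sort mu) mu1).
exists Q => h.
have ih : Q.-integrable setT (EFin \o h).
  apply/integrableP; split => //=.
  by rewrite (ge0_int (fun k => `|h k|)) ?ltry.
split=> //.
have -> : (\int[Q]_k (h k)%:E =
    \int[Q]_k (Num.max (h k) 0)%:E - \int[Q]_k (Num.max (- h k) 0)%:E)%E.
  rewrite integralE; congr (_ - _)%E; apply: eq_integral => k _.
  - by rewrite funeposE /= EFin_max.
  - by rewrite funenegE /= EFin_max.
rewrite !ge0_int; try by move=> k; rewrite le_max lexx orbT.
rewrite -EFinB -sumrB; congr _%:E; apply: eq_bigr => i _.
rewrite -mulrBr; congr (_ * _).
by case: (leP 0 (h i)) => hi; case: (leP 0 (- h i)) => nhi; lra.
Qed.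

Section jensen_from_expectations.
Variables (R : realType) (n : nat) (K : set 'rV[R]_n) (sigma : R -> R).
Variable f : 'rV[R]_n -> R.

Lemma mean_convex_jensen x : mean_convex_at K sigma f x ->
  jensen_convex_at K sigma f x.
Proof.
move=> f_mean xs lam Kxs lam_wgt lamx.
have [Q QP] := weighted_dirac_law lam_wgt.
pose Xf : nat -> borel_rV R n := fun k => xs (inord k).
have mX : measurable_fun setT Xf by exact: measurable_fun_nat.
pose X : {RV Q >-> borel_rV R n} :=
  HB.pack Xf (isMeasurableFun.Build _ _ _ _ Xf mX).
have [|||_] := f_mean _ _ Q X.
- by move=> k; exact: Kxs.
- exists (\sum_j enorm (xs j)) => k; rewrite (bigD1 (inord k)) //= lerDl.
  by apply: sumr_ge0 => j _; exact: enorm_ge0.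
- move=> i; rewrite unlock (proj2 (QP _)); congr _%:E.
  rewrite -lamx summxE; apply: eq_bigr => j _.
  by rewrite mxE /coordinate /= /Xf inord_val.
rewrite unlock !(proj2 (QP _)) lee_fin /jensen_convex lamx.
under eq_bigr do rewrite /= /Xf inord_val mulrBr.
rewrite sumrB -mulr_suml (proj2 lam_wgt) mul1r.
by under [in leRHS]eq_bigr do rewrite /= /Xf inord_val.
Qed.

(** The martingale starts at the constant barycenter and jumps to [xs i] with probability
    [lam i]. *)
Lemma martingale_convex_jensen : convex_set K -> martingale_convex K sigma f ->
  jensen_convex_on K sigma f.
Proof.
move=> convexK f_mart xs lam Kxs lam_wgt.
have Kx := barycenter_in_convex convexK Kxs lam_wgt.
set x := barycenter lam xs in Kx.
have [Q QP] := weighted_dirac_law lam_wgt.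
pose Xf : nat -> borel_rV R n := fun k => xs (inord k).
have mX : measurable_fun setT Xf by exact: measurable_fun_nat.
pose X1 : {RV Q >-> borel_rV R n} :=
  HB.pack Xf (isMeasurableFun.Build _ _ _ _ Xf mX).
pose Xc : nat -> borel_rV R n := fun=> x.
have mXc : measurable_fun setT Xc by exact: measurable_fun_nat.
pose X0 : {RV Q >-> borel_rV R n} :=
  HB.pack Xc (isMeasurableFun.Build _ _ _ _ Xc mXc).
have X1_mean i : (\int[Q]_k (coordinate X1 i k)%:E = (x 0 i)%:E)%E.
  rewrite (proj2 (QP _)); congr _%:E; rewrite /x summxE; apply: eq_bigr => j _.
  by rewrite mxE /coordinate /= /Xf inord_val.
have X0_mean i : (\int[Q]_k (coordinate X0 i k)%:E = (x 0 i)%:E)%E.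
  rewrite (proj2 (QP _)) -mulr_suml (proj2 lam_wgt) mul1r //.
have bX0 : bounded_rv X0 by exists (enorm x).
have bX1 : bounded_rv X1.
  exists (\sum_j enorm (xs j)) => k; rewrite (bigD1 (inord k)) //= lerDl.
  by apply: sumr_ge0 => j _; exact: enorm_ge0.
have mart : one_step_martingale X0 X1.
  move=> i; split; [exact: (proj1 (QP _)) | exact: measurable_cst |
    exact: (proj1 (QP _)) |].
  (* A constant generates the trivial sigma-algebra, so only the empty event and the whole space
     remain. *)
  move=> _ [B mB <-]; rewrite setTI preimage_cst.
  by case: ifP => _; rewrite ?integral_set0 // X0_mean X1_mean.
have exY : expectation_exists Q (fun k => f (X0 k) - f (X1 k)).
  split; first exact: measurable_fun_nat.
  by left; rewrite ltey_eq integrable_pos_fin_num //; exact: (proj1 (QP _)).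
have := f_mart _ _ Q X0 X1 (fun=> Kx) (fun k => Kxs _) bX0 bX1 mart exY.
rewrite unlock !(proj2 (QP _)) lee_fin /jensen_convex -/x.
under eq_bigr do rewrite /= /Xc /Xf inord_val mulrBr.
rewrite sumrB -mulr_suml (proj2 lam_wgt) mul1r.
by under [in leRHS]eq_bigr do rewrite /= /Xc /Xf inord_val.
Qed.

End jensen_from_expectations.

(** * Reduction of the smooth case to the convex one by changing signs *)

Section negation.
Variables (R : realType) (n : nat) (K : set 'rV[R]_n) (sigma : R -> R).
Variable f : 'rV[R]_n -> R.
Local Notation nsigma := (fun t : R => - sigma t).
Local Notation nf := (fun x : 'rV[R]_n => - f x).

Lemma uniformly_smooth_at_opp x gamma :
  uniformly_smooth_at K sigma f x gamma <->
  uniformly_convex_at K nsigma nf x (- gamma).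
Proof.
by split=> f_smooth y /f_smooth; rewrite dotvNl; lra.
Qed.

Lemma exists_uniformly_smooth_at_opp x :
  (exists gamma, uniformly_smooth_at K sigma f x gamma) <->
  (exists gamma, uniformly_convex_at K nsigma nf x gamma).
Proof.
split=> -[gamma gammaP]; exists (- gamma); first exact/uniformly_smooth_at_opp.
by apply/uniformly_smooth_at_opp; rewrite opprK.
Qed.

Lemma uniformly_smooth_on_opp :
  uniformly_smooth_on K sigma f <-> uniformly_convex_on K nsigma nf.
Proof.
split=> -[gamma gammaP]; exists (fun x => - gamma x) => x Kx.
  exact/uniformly_smooth_at_opp/gammaP.
by apply/uniformly_smooth_at_opp; rewrite opprK; exact: gammaP.
Qed.

Lemma jensen_smooth_opp m (lam : 'I_m -> R) (xs : 'I_m -> 'rV[R]_n) :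
  jensen_smooth sigma f lam xs <-> jensen_convex nsigma nf lam xs.
Proof.
rewrite /jensen_smooth /jensen_convex.
under [in X in _ <-> X]eq_bigr do rewrite mulrN.
under [X in _ <-> _ <= - X]eq_bigr do rewrite mulrN.
by rewrite !sumrN; split; lra.
Qed.

Lemma jensen_smooth_at_opp x :
  jensen_smooth_at K sigma f x <-> jensen_convex_at K nsigma nf x.
Proof.
by split=> h xs lam Kxs lam_wgt lamx; apply/jensen_smooth_opp; exact: h.
Qed.

Lemma jensen_smooth_on_opp :
  jensen_smooth_on K sigma f <-> jensen_convex_on K nsigma nf.
Proof.
by split=> h xs lam Kxs lam_wgt; apply/jensen_smooth_opp; exact: h.
Qed.

Lemma expectation_exists_opp d (T : measurableType d) (P : probability T R)
  (Y : T -> R) : expectation_exists P Y -> expectation_exists P (\- Y)%R.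
Proof.
move=> [mY Yfin]; split; first exact: measurable_funN.
rewrite (_ : EFin \o (\- Y)%R = \- (EFin \o Y))%E // funeposN funenegN.
by case: Yfin; [right|left].
Qed.

(** Existence matters: if both parts had infinite integral, the convention [+oo - +oo = -oo] would
    give [Y] and its opposite the same expectation [-oo]. *)
Lemma expectation_opp d (T : measurableType d) (P : probability T R)
  (Y : T -> R) : expectation_exists P Y -> 'E_P[(\- Y)%R]%E = (- 'E_P[Y])%E.
Proof.
move=> [mY Yfin]; rewrite unlock; rewrite -integralN //.
have Yp_ge0 : (0 <= \int[P]_w (EFin \o Y)^\+ w)%E by exact: integral_ge0.
have Yn_ge0 : (0 <= \int[P]_w (EFin \o Y)^\- w)%E by exact: integral_ge0.
move: Yfin Yp_ge0 Yn_ge0; rewrite /adde_def.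
by case: (\int[P]_w _)%E => [a| |] //; case: (\int[P]_w _)%E => [b| |] // [].
Qed.

Hypothesis sigma_cont : continuous sigma.

Lemma expectation_exists_sigma_enormB d (T : measurableType d)
    (P : probability T R) (X0 X1 : T -> borel_rV R n) :
  measurable_fun setT X0 -> measurable_fun setT X1 ->
  bounded_rv X0 -> bounded_rv X1 ->
  expectation_exists P (fun w => sigma (enorm ((X0 w : 'rV[R]_n) - X1 w))).
Proof.
move=> mX0 mX1 bX0 bX1.
have iS := integrable_sigma_enormB P sigma_cont mX0 mX1 bX0 bX1.
split; first by apply/measurable_EFinP; exact: measurable_int iS.
by left; rewrite ltey_eq integrable_pos_fin_num.
Qed.

Lemma expectation_le_opp d (T : measurableType d) (P : probability T R)
    (Y S : T -> R) : expectation_exists P Y -> expectation_exists P S ->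
  ('E_P[Y] >= - 'E_P[S])%E <-> ('E_P[(\- Y)%R] <= - 'E_P[(\- S)%R])%E.
Proof.
by move=> exY exS; rewrite !expectation_opp // oppeK leeNl.
Qed.

Lemma oppB_fun (T : Type) (a b : T -> R) :
  (fun w => - a w - - b w) = (\- (fun w => a w - b w))%R.
Proof. by apply/funext => w; rewrite /= opprK addrC opprB. Qed.

Lemma expectation_exists_oppE d (T : measurableType d) (P : probability T R)
  (Y : T -> R) : expectation_exists P (\- Y)%R <-> expectation_exists P Y.
Proof.
split; last exact: expectation_exists_opp.
move=> /expectation_exists_opp; congr expectation_exists.
by apply/funext => w; rewrite /= opprK.
Qed.

Lemma martingale_smooth_opp :
  martingale_smooth K sigma f <-> martingale_convex K nsigma nf.
Proof.
split=> h d T P X0 X1 KX0 KX1 bX0 bX1 mart exY;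
  have exS := @expectation_exists_sigma_enormB _ _ P X0 X1
    (measurable_funPT X0) (measurable_funPT X1) bX0 bX1.
- rewrite oppB_fun in exY *; move/expectation_exists_oppE in exY.
  by apply/expectation_le_opp => //; exact: h.
- apply/expectation_le_opp => //; move/expectation_exists_oppE : (exY).
  by rewrite -!oppB_fun; exact: h.
Qed.

Lemma mean_smooth_at_opp x :
  mean_smooth_at K sigma f x <-> mean_convex_at K nsigma nf x.
Proof.
split=> h d T P X KX bX Xx;
  have bx : bounded_rv (cst x : T -> borel_rV R n) by exists (enorm x).
all: have exS := @expectation_exists_sigma_enormB _ _ P (cst x) X
    (measurable_cst _) (measurable_funPT X) bx bX.
all: have [exY le_Y] := h d T P X KX bX Xx.
- rewrite (oppB_fun (cst (f x)) (fun w => f (X w))).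
  by split; [exact/expectation_exists_oppE|exact/expectation_le_opp].
- rewrite (oppB_fun (cst (f x)) (fun w => f (X w))) in exY le_Y.
  move/expectation_exists_oppE in exY.
  by split=> //; exact/expectation_le_opp.
Qed.

End negation.

(** * Continuity from local Lipschitz bounds *)

Lemma locally_lipschitz_continuous (R : realType) (sigma : R -> R) :
  locally_lipschitz_on (fun t : R => `|t|) setT sigma -> continuous sigma.
Proof.
move=> sigma_lip t; have [U tU [L LP]] := sigma_lip t I.
apply/cvgrPdist_lt => e e_gt0.
have L_gt0 : 0 < `|L| + 1 by rewrite ltr_wpDl.
have near_t : \forall z \near t, `|t - z| < e / (`|L| + 1).
  by apply: (@nbhsx_ballx _ _ t); exact: divr_gt0.
have Ut := nbhs_singleton tU.
apply: filterS2 tU near_t => z Uz.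
rewrite ltr_pdivlMr // => tz.
have := LP t z (conj Ut I) (conj Uz I).
have := normr_ge0 (t - z); have := ler_norm L; nra.
Qed.

Lemma locally_lipschitz_continuous_at (R : realType) (n : nat)
    (K : set 'rV[R]_n) (f : 'rV[R]_n -> R) :
  open K -> locally_lipschitz_on (@enorm R n) K f ->
  forall x, K x -> {for x, continuous f}.
Proof.
move=> openK f_lip x Kx; have [U xU [L LP]] := f_lip x Kx.
apply/(@cvgrPdist_lt _ _ _ (nbhs x) (nbhs_filter x)) => e e_gt0.
have L_gt0 : 0 < `|L| + 1 by rewrite ltr_wpDl.
have near_x := nbhs_enorm x (divr_gt0 e_gt0 L_gt0).
have xK : nbhs x K by exact: open_nbhs_nbhs.
have Ux := nbhs_singleton xU.
have near_all : nbhs x (U `&` (K `&` [set z | enorm (z - x) < e / (`|L| + 1)])).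
  by apply: filterI => //; apply: filterI.
apply: (@filterS _ _ (nbhs_filter x) _ _ _ near_all) => z [Uz [Kz /=]].
rewrite ltr_pdivlMr // => xz.
have := LP x z (conj Ux Kx) (conj Uz Kz).
rewrite enormB; have := enorm_ge0 (z - x); have := ler_norm L; nra.
Qed.

Lemma locally_lipschitz_opp (R : realType) (V : normedModType R)
    (nrm : V -> R) (A : set V) (g : V -> R) :
  locally_lipschitz_on nrm A (fun v => - g v) <-> locally_lipschitz_on nrm A g.
Proof.
by split=> h x /h[U xU [L LP]]; exists U => //; exists L => y z Uy Uz;
  have := LP y z Uy Uz; rewrite -opprD ?normrN // opprK.
Qed.

(** * Assembly of the equivalences *)

Section convex_case.
Variables (R : realType) (n : nat) (K : set 'rV[R]_n) (sigma : R -> R).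
Variable f : 'rV[R]_n -> R.
Hypotheses (openK : open K) (convexK : convex_set K).

(** Jensen's inequality first yields uniform convexity, hence the Lipschitz bound, hence the
    continuity of [f] that the passage to martingales requires. *)
Lemma convex_conditions_locally_lipschitz : sigma 0 = 0 ->
  locally_lipschitz_on (fun t : R => `|t|) setT sigma ->
  [/\ uniformly_convex_on K sigma f <-> jensen_convex_on K sigma f,
      jensen_convex_on K sigma f <-> martingale_convex K sigma f &
      uniformly_convex_on K sigma f -> locally_lipschitz_on (@enorm R n) K f].
Proof.
move=> sigma0 sigma_lip.
have lip := uniformly_convex_locally_lipschitz openK sigma0 sigma_lip.
have jensenP := uniformly_convex_on_jensenP sigma f openK convexK.
split; [exact: jensenP| |exact: lip].
split; last exact: martingale_convex_jensen.
move=> f_jensen; have f_convex := proj2 jensenP f_jensen.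
apply: uniformly_convex_martingale => //.
  exact: locally_lipschitz_continuous.
exact: (locally_lipschitz_continuous_at openK (lip _ f_convex)).
Qed.

Lemma convex_conditions_at x : continuous sigma -> {within K, continuous f} ->
  K x ->
  ((exists gamma, uniformly_convex_at K sigma f x gamma) <->
     jensen_convex_at K sigma f x) /\
  (jensen_convex_at K sigma f x <-> mean_convex_at K sigma f x).
Proof.
rewrite (continuous_open_subspace f openK) => sigma_cont f_cont Kx.
have xK : nbhs x K by exact: open_nbhs_nbhs.
split; first exact: uniformly_convex_at_jensenP.
split; last exact: mean_convex_jensen.
move=> /(jensen_uniformly_convex_at xK)[gamma].
by apply: uniformly_convex_mean => // y Ky; apply: f_cont; rewrite inE.
Qed.

End convex_case.

Theorem theorem7p3 (R : realType) (n : nat) (K : set 'rV[R]_n)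
    (openK : open K) (convexK : convex_set K)
    (sigma : R -> R) (sigma0 : sigma 0 = 0) (f : 'rV[R]_n -> R) :
  (locally_lipschitz_on (fun t : R => `|t|) setT sigma ->
     [/\ (uniformly_convex_on K sigma f <-> jensen_convex_on K sigma f) /\
         (jensen_convex_on K sigma f <-> martingale_convex K sigma f),
         (uniformly_smooth_on K sigma f <-> jensen_smooth_on K sigma f) /\
         (jensen_smooth_on K sigma f <-> martingale_smooth K sigma f) &
         [\/ uniformly_convex_on K sigma f \/ uniformly_smooth_on K sigma f,
             jensen_convex_on K sigma f \/ jensen_smooth_on K sigma f |
             martingale_convex K sigma f \/ martingale_smooth K sigma f] ->
         locally_lipschitz_on (@enorm R n) K f])
  /\
  (continuous sigma -> {within K, continuous f} ->
     forall x : 'rV[R]_n, K x ->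
       (((exists gamma, uniformly_convex_at K sigma f x gamma) <->
           jensen_convex_at K sigma f x) /\
        (jensen_convex_at K sigma f x <-> mean_convex_at K sigma f x)) /\
       (((exists gamma, uniformly_smooth_at K sigma f x gamma) <->
           jensen_smooth_at K sigma f x) /\
        (jensen_smooth_at K sigma f x <-> mean_smooth_at K sigma f x))).
Proof.
split=> [sigma_lip|sigma_cont f_cont x Kx].
  have sigma_cont := locally_lipschitz_continuous sigma_lip.
  have [ic jc lc] :=
    convex_conditions_locally_lipschitz f openK convexK sigma0 sigma_lip.
  have [||is_ js ls] := @convex_conditions_locally_lipschitz R n K
    (fun t => - sigma t) (fun v => - f v) openK convexK.
  - by rewrite sigma0 oppr0.
  - exact/locally_lipschitz_opp.
  rewrite (propext (uniformly_smooth_on_opp K sigma f)).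
  rewrite (propext (jensen_smooth_on_opp K sigma f)).
  rewrite (propext (martingale_smooth_opp K f sigma_cont)).
  (* All conditions are now convex ones, for [f] or for its opposite; identifying equivalent ones
     leaves trivial equivalences and the Lipschitz claim. *)
  rewrite -(propext jc) -(propext js) -(propext ic) -(propext is_).
  split=> // f_cond.
  have [/lc//|/ls f_lip] : uniformly_convex_on K sigma f \/
    uniformly_convex_on K (fun t => - sigma t) (fun v => - f v) by case: f_cond.
  exact/locally_lipschitz_opp.
split; first exact: convex_conditions_at.
rewrite (propext (exists_uniformly_smooth_at_opp K sigma f x)).
rewrite (propext (jensen_smooth_at_opp K sigma f x)).
rewrite (propext (mean_smooth_at_opp K f sigma_cont x)).
apply: convex_conditions_at => // t; apply: cvgN; first exact: sigma_cont.
exact: f_cont.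
Qed.
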